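(* For polluted modified bootstrap percolation on $\mathbb{Z}^2$ with parameters $p,q$ satisfying $$q\le\frac{p^2}{\log(1/p)\,(\log\log(1/p))^4},$$ one has $$\lim_{p\to 0}\mathbb{P}_{p,q}\bigl((0,0)\text{ is eventually occupied}\bigr)=1.$$ Explicitly: for every $\eta>0$ there is $p_0\in(0,1/e)$ such that for all $p\in(0,p_0)$ and all $q\ge 0$ with $p+q\le 1$ satisfying the displayed upper bound on $q$, one has $\mathbb{P}_{p,q}\bigl((0,0)\text{ is eventually occupied}\bigr)\ge 1-\eta$.
   Context: Polluted modified bootstrap percolation: each site of $\mathbb{Z}^2$ is in one of three states: occupied, closed, or open. Under $\mathbb{P}_{p,q}$ (where $p+q\le 1$), the initial states of the sites are independent, each site being occupied with probability $p$, closed with probability $q$, and open with probability $1-p-q$. The configuration then evolves deterministically in discrete time: occupied and closed sites never change state; an open site $x$ at time $t$ becomes occupied at time $t+1$ if and only if, at time $t$, at least one of its two horizontal neighbors $x\pm e_1$ is occupied and at least one of its two vertical neighbors $x\pm e_2$ is occupied. A site is eventually occupied if it is occupied at some time $t\ge 0$. Here $\log$ is the natural logarithm. *)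

(* Defs.v *)
From HB Require Import structures.
From mathcomp Require Import all_boot all_order all_algebra finmap.
From mathcomp Require Import all_classical all_reals all_analysis.

Set Implicit Arguments.
Unset Strict Implicit.
Unset Printing Implicit Defensive.

Import Order.TTheory GRing.Theory Num.Theory.

Local Open Scope classical_set_scope.
Local Open Scope ring_scope.

Inductive site_state := Occupied | Closed | Open.

Definition option_of_site_state (s : site_state) : option bool :=
  match s with Occupied => Some true | Closed => Some false | Open => None end.

Definition site_state_of_option (o : option bool) : site_state :=
  match o with Some true => Occupied | Some false => Closed | None => Open end.

Lemma option_of_site_stateK :
  cancel option_of_site_state site_state_of_option.
Proof. by case. Qed.

HB.instance Definition _ := Finite.copy site_state
  (can_type option_of_site_stateK).
HB.instance Definition _ := isPointed.Build site_state Open.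
HB.instance Definition _ := @isMeasurable.Build default_measure_display
  site_state discrete_measurable discrete_measurable0
  discrete_measurableC discrete_measurableU.

Notation Z2 := (int * int)%type.

Definition e1 : Z2 := (1, 0).
Definition e2 : Z2 := (0, 1).

Definition configuration := Z2 -> site_state.

Definition step (c : configuration) : configuration := fun x =>
  if [&& c x == Open,
         (c (x + e1) == Occupied) || (c (x - e1) == Occupied) &
         (c (x + e2) == Occupied) || (c (x - e2) == Occupied)]
  then Occupied else c x.

Definition eventually_occupied (c : configuration) (x : Z2) : Prop :=
  exists t : nat, iter t step c x = Occupied.

Definition mutually_independent d d' (T : measurableType d)
    (E : measurableType d') (R : realType) (P : probability T R)
    (I : choiceType) (X : I -> {RV P >-> E}) : Prop :=
  forall (J : {fset I}) (A : I -> set E), (forall i, measurable (A i)) ->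
    P (\bigcap_(i in [set` J]) (X i @^-1` A i)) =
      (\prod_(i <- J) P (X i @^-1` A i))%E.

Definition site_law (R : realType) (p q : R) (s : site_state) : R :=
  match s with Occupied => p | Closed => q | Open => 1 - p - q end.

(* The law P_{p,q} enters through its realizations: X is an arbitrary random
   field on an arbitrary probability space with i.i.d. sites of law site_law. *)
Definition polluted_initial_field d (T : measurableType d) (R : realType)
    (P : probability T R) (p q : R) (X : Z2 -> {RV P >-> site_state}) : Prop :=
  mutually_independent X /\
  forall (x : Z2) (s : site_state),
    distribution P (X x) [set s] = (site_law p q s)%:E.

Lemma measurable_eventually_occupied d (T : measurableType d) (R : realType)
    (P : probability T R) (X : Z2 -> {RV P >-> site_state}) (x : Z2) :
  measurable [set w | eventually_occupied (fun y => X y w) x].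
Proof.
suff mX t : forall y (s : site_state),
    measurable [set w | iter t step (fun z => X z w) y = s].
  rewrite (_ : [set w | _] = \bigcup_t
    [set w | iter t step (fun z => X z w) x = Occupied]).
    by apply: bigcupT_measurable => t; exact: mX.
  by apply/seteqP; split=> w /= [t]; exists t.
elim: t => [|t IHt] y s /=.
  exact: (measurable_funPTI (X y) (Y := [set s])).
pose occ z := [set w | iter t step (fun z => X z w) z = Occupied].
pose B := [set w | iter t step (fun z => X z w) y = Open]
  `&` (occ (y + e1) `|` occ (y - e1)) `&` (occ (y + e2) `|` occ (y - e2)).
have mB : measurable B by do ![apply: measurableI|apply: measurableU|apply: IHt].
rewrite (_ : [set w | _] = (B `&` [set _ | Occupied = s])
  `|` (~` B `&` [set w | iter t step (fun z => X z w) y = s])).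
  apply: measurableU; apply: measurableI => //; last exact: measurableC.
  by have [->|ne] := pselect (Occupied = s);
    [rewrite (_ : [set _ | _] = setT)|rewrite (_ : [set _ | _] = set0)] => //;
    apply/seteqP; split.
have BE w : B w <-> [&& iter t step (fun z => X z w) y == Open,
    (iter t step (fun z => X z w) (y + e1) == Occupied)
      || (iter t step (fun z => X z w) (y - e1) == Occupied) &
    (iter t step (fun z => X z w) (y + e2) == Occupied)
      || (iter t step (fun z => X z w) (y - e2) == Occupied)].
  split=> [[[/eqP h1 h2] h3]|/and3P[/eqP h1 /orP h2 /orP h3]].
    by apply/and3P; split=> //; apply/orP;
      [case: h2|case: h3] => /eqP; [left|right|left|right].
  by split; [split=> //|]; [case: h2|case: h3] => /eqP; [left|right|left|right].
apply/seteqP; split=> w /=; rewrite [step _ _]/step; case: ifPn => h.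
- by left; split=> //; apply/(BE w).
- by right; split=> // /(BE w); exact/negP.
- by case=> [[]//|[nB _]]; case: nB; apply/(BE w).
- by case=> [[/(BE w) b]|[]//]; case/negP: h.
Qed.

(* Main.v *)
Require Import Defs.
From mathcomp Require Import all_boot all_order all_algebra finmap.
From mathcomp Require Import all_classical all_reals all_analysis.
From mathcomp Require Import zify ring lra.

Set Implicit Arguments.
Unset Strict Implicit.
Unset Printing Implicit Defensive.

Import Order.TTheory GRing.Theory Num.Theory.

Local Open Scope classical_set_scope.
Local Open Scope ring_scope.

(** Let [y = log (1/p)] and [x = log y]. Measured in units of [1/p], closed sites
have density at most [1 / (y * x ^ 4)], and a segment has to have length of order
[y] before segments of that length are all hit by occupied sites. The plane is
tiled by boxes of side of order [x * y / p].

The reason why growth succeeds is that occupied sites are hardly ever needed. If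
the left column and the bottom row of a region are filled, then the region fills
by itself: a site with a filled left and a filled lower neighbour becomes
occupied. Closed sites cast shadows, namely the rest of their row and column, but
a shadow ends at the first occupied site in it, typically after distance [1 / p],
and behind it the corner keeps growing. This works as soon as closed sites are
isolated at the scale [x / p] of the longest shadows ([corner_growth]). Long
segments of length [y / p] free of closed sites are needed only to start a new
column next to a flat front, and one such segment per strip suffices, because
the rest of the strip fills from the two corners that it creates
([strip_growth]). There are about [x] places to look for this segment, each
with failure probability of order [1 / x ^ 2]. Accordingly a box is called good
if its closed sites are isolated, away from the border and have short shadows,
and if these segments exist; a good box is filled as soon as one adjacent good box is
([directed_fill]). First moment bounds show that a box is bad with probability at
most [32 / x] ([box_status_bad_small]).

What remains is percolation of independent good boxes, together with the
existence of a source, a completely occupied box, which is extremely rare.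
Blocks of 3 by 3 boxes, blocks of 3 by 3 such blocks, and so on, are declared
bad if at least two of their sub-blocks are bad. Since a 3 by 3 grid with one
site removed is connected, filling spreads between adjacent good blocks at each
level ([coarse_propagates]). If [theta] is the probability that a block is bad,
it is at most [81 * theta ^ 2] one level up, so all blocks that contain the origin
are good with probability at least [1 - 2 * theta], [theta] being that of a box.
The probability that the block of the origin contains a source whose blocks are
all good tends to one with the level ([charged_limit]), and then the filling is
passed down to the origin ([origin_filled]). *)

(** * Growth from a corner *)

Definition in_rect (x0 x1 y0 y1 x y : int) : Prop :=
  x0 <= x < x1 /\ y0 <= y < y1.

(** Locally [F] plays the part of the set of eventually occupied sites. Only
closure under the rule is used, and only inside [dom], so that the lemmas
below can be applied to reflected and transposed copies of a box. *)
Definition growth_closed (dom : int -> int -> Prop)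
    (clo occ F : int -> int -> Prop) : Prop :=
  (forall x y, dom x y -> occ x y -> F x y) /\
  (forall x y, dom x y -> ~ clo x y ->
     F (x - 1) y \/ F (x + 1) y -> F x (y - 1) \/ F x (y + 1) -> F x y).

Definition isolated (dom clo : int -> int -> Prop) (r : nat) : Prop :=
  forall x y x' y', dom x y -> dom x' y' -> clo x y -> clo x' y' ->
    `|x - x'| <= r%:Z -> `|y - y'| <= r%:Z -> x = x' /\ y = y'.

Definition right_arm (occ : int -> int -> Prop) (r : nat) (x y : int) : Prop :=
  exists k : nat, (0 < k <= r)%N /\ occ (x + k%:Z) y.

(** How a front gets past an isolated closed site [(a, b)]. The sites
[(a + i, b - j)] on or below the antidiagonal of [(a, b)] are known to be
filled; those above it fill by induction on [i - j], because the left and the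
lower neighbour both have a smaller difference and no second closed site is
near. This brings the filled region under the whole right arm of [(a, b)], and
the arm then fills backwards from its occupied site. *)
Lemma fill_past_closed (clo occ F : int -> int -> Prop) (x0 x1 y0 y1 : int)
    (r : nat) (a b : int) :
  growth_closed (in_rect x0 x1 y0 y1) clo occ F ->
  (forall x, x0 <= x < x1 -> F x (y0 - 1)) ->
  (forall x y, in_rect x0 x1 y0 y1 x y -> clo x y ->
     `|x - a| <= r%:Z -> `|y - b| <= r%:Z -> x = a /\ y = b) ->
  (forall x y, in_rect x0 x1 y0 y1 x y -> ~ clo x y -> x + y <= a + b -> F x y) ->
  x0 - 1 <= a -> y0 <= b < y1 -> a + r%:Z < x1 -> right_arm occ r a b ->
  F (a + 1) b.
Proof.
move=> [Focc Frule] bot iso low xa yb ax1 [k [k_r occk]].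
have nclo (i j : nat) : (0 < i <= r)%N -> (j <= r)%N ->
    y0 <= b - j%:Z -> ~ clo (a + i%:Z) (b - j%:Z).
  move=> ir jr yj cl.
  have [] : a + i%:Z = a /\ b - j%:Z = b by apply: iso => //; try split; lia.
  lia.
have below (d i j : nat) : (0 < j)%N -> i = (j + d)%N -> (i <= r)%N ->
    y0 - 1 <= b - j%:Z -> F (a + i%:Z) (b - j%:Z).
  elim: d i j => [|d IHd] i j j0 ijd ir yj.
    have [->|/eqP yj'] := eqVneq (b - j%:Z) (y0 - 1); first by apply: bot; lia.
    apply: low; [by split; lia|by apply: nclo; lia|lia].
  have [->|/eqP yj'] := eqVneq (b - j%:Z) (y0 - 1); first by apply: bot; lia.
  apply: Frule; first by split; lia.
  - by apply: nclo; lia.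
  - left; have -> : a + i%:Z - 1 = a + i.-1%:Z by lia.
    by apply: IHd; lia.
  - left; have -> : b - j%:Z - 1 = b - j.+1%:Z by lia.
    by apply: IHd; lia.
have arm (d i : nat) : (0 < i)%N -> (i + d)%N = k -> F (a + i%:Z) b.
  elim: d i => [|d IHd] i i0 idk.
    by apply: Focc; [split; lia|have -> : i = k by lia].
  apply: Frule; first by split; lia.
  - by have := nclo i 0%N; rewrite subr0; apply; lia.
  - right; have -> : a + i%:Z + 1 = a + i.+1%:Z by lia.
    by apply: IHd; lia.
  - by left; have := below i.-1 i 1%N; apply; lia.
by have := arm k.-1 1%N; apply; lia.
Qed.

(** Growth from a corner needs no occupied site at all, except to end the shadows
of closed sites. An unfilled site with minimal [x + y] has a closed site to its
left or below it, and then [fill_past_closed] applies, directly or after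
exchanging the coordinates. *)
Lemma corner_growth (clo occ F : int -> int -> Prop) (x0 x1 y0 y1 : int)
    (r : nat) :
  growth_closed (in_rect x0 x1 y0 y1) clo occ F ->
  (forall y, y0 <= y < y1 -> F (x0 - 1) y) ->
  (forall x, x0 <= x < x1 -> F x (y0 - 1)) ->
  isolated (in_rect x0 x1 y0 y1) clo r ->
  (forall x y, in_rect x0 x1 y0 y1 x y -> clo x y ->
     [/\ x + r%:Z < x1, y + r%:Z < y1, right_arm occ r x y &
         right_arm (fun u v => occ v u) r y x]) ->
  forall x y, in_rect x0 x1 y0 y1 x y -> ~ clo x y -> F x y.
Proof.
move=> gc left bot iso arms.
have [Focc Frule] := gc.
suff H (m : nat) : forall x y, in_rect x0 x1 y0 y1 x y ->
    x + y <= x0 + y0 + m%:Z -> ~ (clo x y) -> F x y.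
  by move=> x y xy; apply: (H `|(x + y - x0 - y0)%R|%N) => //; case: xy; lia.
elim: m => [|m IHm] x y [xx yy] xym ncl.
  by apply: Frule => //; left; [have -> : x = x0 by lia|have -> : y = y0 by lia];
    [apply: left|apply: bot]; lia.
have low x' y' : in_rect x0 x1 y0 y1 x' y' -> ~ clo x' y' ->
    x' + y' <= x + y - 1 -> F x' y'.
  by move=> xy' cl' s; apply: IHm => //; lia.
have near u v : in_rect x0 x1 y0 y1 u v -> clo u v -> forall x' y',
    in_rect x0 x1 y0 y1 x' y' -> clo x' y' ->
    `|x' - u| <= r%:Z -> `|y' - v| <= r%:Z -> x' = u /\ y' = v.
  by move=> uv cuv x' y' xy' cl'; apply: iso.
have [Fl|nFl] := EM (F (x - 1) y).
  have [Fb|nFb] := EM (F x (y - 1)); first by apply: Frule => //; left.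
  have /eqP yy0 : y != y0 by apply/eqP => yy0; apply: nFb; rewrite yy0; apply: bot; lia.
  have rb : in_rect x0 x1 y0 y1 x (y - 1) by split; lia.
  have cb : clo x (y - 1) by apply: contrapT => /(low _ _ rb); apply: contra_not nFb; apply; lia.
  have [ax ay _ armu] := arms _ _ rb cb.
  have -> : y = y - 1 + 1 by lia.
  apply: (@fill_past_closed (fun u v => clo v u) (fun u v => occ v u)
    (fun u v => F v u) y0 y1 x0 x1 r (y - 1) x) => //; try lia.
  - split=> [u v [] *|u v [] *]; first by apply: Focc => //; split.
    by apply: Frule => //; split.
  - move=> u v [] uu vv cl h1 h2.
    by have [] := near _ _ rb cb v u _ cl h2 h1.
  - move=> u v [] uu vv cl h; apply: low => //; lia.
have /eqP xx0 : x != x0 by apply/eqP => xx0; apply: nFl; rewrite xx0; apply: left; lia.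
have rl : in_rect x0 x1 y0 y1 (x - 1) y by split; lia.
have cl : clo (x - 1) y by apply: contrapT => /(low _ _ rl); apply: contra_not nFl; apply; lia.
have [ax ay armr _] := arms _ _ rl cl.
have -> : x = x - 1 + 1 by lia.
apply: (@fill_past_closed clo occ F x0 x1 y0 y1 r (x - 1) y) => //; try lia.
- by apply: near.
- by move=> u v uv cuv h; apply: low => //; lia.
Qed.

(** * Filling a good box from one side *)

Lemma column_growth (dom clo occ F : int -> int -> Prop) (x c0 c1 y1 : int) :
  growth_closed dom clo occ F ->
  (forall y, c0 <= y < c1 -> dom x y /\ ~ clo x y) ->
  (forall y, c0 <= y < c1 -> F (x - 1) y) ->
  c0 <= y1 < c1 -> occ x y1 -> forall y, c0 <= y < c1 -> F x y.
Proof.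
move=> [Focc Frule] ok left y1c occ1.
have up (d : nat) : y1 + d%:Z < c1 -> F x (y1 + d%:Z).
  elim: d => [|d IHd] dc.
    by rewrite addr0; apply: Focc => //; apply: (ok _ _).1.
  have [|? ?] := ok (y1 + d.+1%:Z); first lia.
  apply: Frule => //; left; first by (apply: left; lia).
  by have -> : y1 + d.+1%:Z - 1 = y1 + d%:Z; [lia|apply: IHd; lia].
have down (d : nat) : c0 <= y1 - d%:Z -> F x (y1 - d%:Z).
  elim: d => [|d IHd] dc.
    by rewrite subr0; apply: Focc => //; apply: (ok _ _).1.
  have [|? ?] := ok (y1 - d.+1%:Z); first lia.
  apply: Frule => //; first by left; (apply: left; lia).
  by right; have -> : y1 - d.+1%:Z + 1 = y1 - d%:Z; [lia|apply: IHd; lia].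
move=> y yc; have [yy|yy] := leP y1 y.
  by have -> : y = y1 + (`|(y - y1)%R|%N)%:Z; [lia|apply: up; lia].
by have -> : y = y1 - (`|(y1 - y)%R|%N)%:Z; [lia|apply: down; lia].
Qed.

Definition left_arm (occ : int -> int -> Prop) (r : nat) (x y : int) : Prop :=
  exists k : nat, (0 < k <= r)%N /\ occ (x - k%:Z) y.

Lemma growth_closedW (dom dom' clo occ F : int -> int -> Prop) :
  (forall x y, dom' x y -> dom x y) ->
  growth_closed dom clo occ F -> growth_closed dom' clo occ F.
Proof. by move=> sub [h1 h2]; split=> x y /sub; [apply: h1|apply: h2]. Qed.

(** Only the block of rows [c0, c1) has to be advanced by means of occupied sites.
Once it has been filled, its top and bottom rows together with the filled
column on the left form two corners, from which the rest of the strip fills by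
[corner_growth], whatever the isolated closed sites do. *)
Lemma strip_growth (clo occ F : int -> int -> Prop) (x0 x1 s0 s1 c0 c1 : int)
    (r : nat) :
  growth_closed (in_rect x0 x1 s0 s1) clo occ F ->
  (forall y, s0 <= y < s1 -> F (x0 - 1) y) ->
  isolated (in_rect x0 x1 s0 s1) clo r ->
  (forall x y, in_rect x0 x1 s0 s1 x y -> clo x y ->
     [/\ x + r%:Z < x1, y + r%:Z < s1 & s0 <= y - r%:Z] /\
     [/\ right_arm occ r x y,
         right_arm (fun u v => occ v u) r y x &
         left_arm (fun u v => occ v u) r y x]) ->
  s0 <= c0 -> c0 < c1 -> c1 <= s1 ->
  (forall x y, in_rect x0 x1 c0 c1 x y -> ~ clo x y) ->
  (forall x, x0 <= x < x1 -> exists y, c0 <= y < c1 /\ occ x y) ->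
  forall x y, in_rect x0 x1 s0 s1 x y -> ~ clo x y -> F x y.
Proof.
move=> gc left iso arms sc c01 cs nclo occs.
have fill x : x0 <= x < x1 -> (forall y, c0 <= y < c1 -> F (x - 1) y) ->
    forall y, c0 <= y < c1 -> F x y.
  move=> xx Fx; have [y1 [y1c occ1]] := occs x xx.
  apply: (column_growth gc _ Fx y1c occ1) => y yc.
  by split; [split; lia|apply: nclo; split; lia].
have mid (d : nat) : x0 + d%:Z < x1 ->
    forall y, c0 <= y < c1 -> F (x0 + d%:Z) y.
  elim: d => [|d IHd] dx; apply: fill; try lia.
    by move=> y yc; rewrite addr0; apply: left; lia.
  by have -> : x0 + d.+1%:Z - 1 = x0 + d%:Z; [lia|apply: IHd; lia].
have {}mid x y : in_rect x0 x1 c0 c1 x y -> F x y.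
  case=> xx yy; have -> : x = x0 + (`|(x - x0)%R|%N)%:Z by lia.
  by apply: mid; lia.
have up : forall x y, in_rect x0 x1 c1 s1 x y -> ~ clo x y -> F x y.
  apply: (@corner_growth clo occ F x0 x1 c1 s1 r).
  - by apply: growth_closedW gc => x y [? ?]; split; lia.
  - by move=> y yy; apply: left; lia.
  - by move=> x xx; apply: mid; split; lia.
  - by move=> x y x' y' [? ?] [? ?]; apply: iso; split; lia.
  - move=> x y [xx yy] cl; have [|[? ? ?] [? ? ?]] := arms x y _ cl.
      by split; lia.
    by split.
have down : forall x y, in_rect x0 x1 (1 - c0) (1 - s0) x y ->
    ~ clo x (- y) -> F x (- y).
  apply: (@corner_growth (fun x y => clo x (- y)) (fun x y => occ x (- y))
    (fun x y => F x (- y)) x0 x1 (1 - c0) (1 - s0) r).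
  - split=> x y [xx yy].
      by apply: gc.1; split; lia.
    have -> : - (y - 1) = - y + 1 by lia.
    have -> : - (y + 1) = - y - 1 by lia.
    move=> ncl Fh Fv; apply: gc.2 => //; first by split; lia.
    by case: Fv; [right|left].
  - by move=> y yy; apply: left; lia.
  - by move=> x xx; apply: mid; split; lia.
  - move=> x y x' y' [? ?] [? ?] cl cl' h1 h2.
    have [] := iso x (- y) x' (- y'); try split; try lia; by [].
  - move=> x y [xx yy] cl; have [|[? ? ?] [? ? [k [kr ok]]]] := arms x (- y) _ cl.
      by split; lia.
    split=> //; try lia; exists k; split=> //.
    by have -> : - (y + k%:Z) = - y - k%:Z by lia.
move=> x y [xx yy] ncl.
have [yc|yc] := leP c1 y; first by apply: up => //; split; lia.
have [yc'|yc'] := leP c0 y; first by apply: mid; split; lia.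
by have := down x (- y); rewrite opprK; apply => //; split; lia.
Qed.

(** The conditions under which a box of side [S] is filled by growth from the left.
Closed sites are farther than [r] from each other and from the border, and
their shadows end within distance [r]. Every strip of width [w] contains a lane
of width [r] and full height without closed sites, at which the growth in that
strip can be cut off without cutting a shadow. Around every boundary of strips
some block of height [l] has no closed sites, and no column of a block is free
of occupied sites. *)
Definition directed_good (r K m : nat) (clo occ : int -> int -> Prop) : Prop :=
  let w := (K * r)%N in let l := (m * w)%N in let S := (K * l)%N in
  let box := in_rect 0 S%:Z 0 S%:Z in
  [/\ isolated box clo r,
      (forall x y, box x y -> clo x y ->
         [/\ r%:Z <= x, x + r%:Z < S%:Z, r%:Z <= y & y + r%:Z < S%:Z]),
      (forall x y, box x y -> clo x y ->
         [/\ right_arm occ r x y,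
             right_arm (fun u v => occ v u) r y x &
             left_arm (fun u v => occ v u) r y x]) &
    [/\ (forall i : nat, (i < K * m)%N -> exists2 j, (j < K)%N &
           forall x y, in_rect (i * w + j * r)%N%:Z (i * w + j * r + r)%N%:Z
             0 S%:Z x y -> ~ clo x y),
        (forall i : nat, (i <= K * m)%N -> exists2 k, (k < K)%N &
           forall x y, box x y ->
             in_rect ((i * w)%N%:Z - w%:Z) (i * w + w)%N%:Z
                     (k * l)%N%:Z (k * l + l)%N%:Z x y -> ~ clo x y) &
        (forall x (k : nat), 0 <= x < S%:Z -> (k < K)%N ->
           exists y, (k * l)%N%:Z <= y < (k * l + l)%N%:Z /\ occ x y)]].

(** The box is filled from one clear lane to the next. The region between two
successive clear lanes lies in two neighbouring strips, hence crosses a closed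
free block, and [strip_growth] applies to it: its left neighbour column lies in
the previous lane, so it is completely filled, and a closed site inside is at
distance more than [r] from the right end. *)
Lemma directed_fill (r K m : nat) (clo occ F : int -> int -> Prop) :
  let S := (K * (m * (K * r)))%N in
  (0 < r)%N -> (0 < K)%N -> (0 < m)%N ->
  directed_good r K m clo occ ->
  growth_closed (in_rect 0 S%:Z 0 S%:Z) clo occ F ->
  (forall y, 0 <= y < S%:Z -> F (- 1) y) ->
  forall x y, in_rect 0 S%:Z 0 S%:Z x y -> ~ clo x y -> F x y.
Proof.
move=> S r0 K0 m0 [iso bdry arms [lanes runs cols]] gc left.
set w := (K * r)%N in bdry arms lanes runs cols *; set l := (m * w)%N in bdry arms lanes runs cols.
have SE : S = (K * m * w)%N by rewrite /S mulnA.
have w0 : (0 < w)%N by rewrite muln_gt0 K0.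
have l0 : (0 < l)%N by rewrite muln_gt0 m0.
have strip (i : nat) (a b : int) : (i <= K * m)%N ->
    0 <= a -> (i * w)%N%:Z <= a + w%:Z -> b <= (i * w + w)%N%:Z -> b <= S%:Z ->
    (forall y, 0 <= y < S%:Z -> F (a - 1) y) ->
    (forall x y, in_rect a b 0 S%:Z x y -> clo x y -> x + r%:Z < b) ->
    forall x y, in_rect a b 0 S%:Z x y -> ~ clo x y -> F x y.
  move=> iK a0 ia bi bS Fa clob.
  have [k kK nclo] := runs i iK.
  have kS : (k * l + l <= S)%N by rewrite -mulSnr /S -/w -/l leq_mul2r kK orbT.
  have sub x y : in_rect a b 0 S%:Z x y -> in_rect 0 S%:Z 0 S%:Z x y.
    by case=> ? ?; split; lia.
  apply: (@strip_growth clo occ F a b 0 S%:Z (k * l)%N%:Z (k * l + l)%N%:Z r) => //.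
  - exact: growth_closedW gc.
  - by move=> x y x' y' /sub xy /sub xy'; exact: iso.
  - move=> x y xy cl; have [? ? ? ?] := bdry x y (sub _ _ xy) cl.
    split; last exact: arms (sub _ _ xy) cl.
    split; [exact: clob xy cl|by []|lia].
  - lia.
  - move=> x y [xx yy]; apply: nclo; split; lia.
  - by move=> x xx; apply: cols => //; lia.
have prefix (i : nat) : (i <= K * m)%N -> exists a : int,
    [/\ 0 <= a, (i * w)%N%:Z <= a + w%:Z, a <= (i * w)%N%:Z,
        (forall y, 0 <= y < S%:Z -> F (a - 1) y) &
        (forall x y, in_rect 0 a 0 S%:Z x y -> ~ clo x y -> F x y)].
  elim: i => [|i IHi] iK.
    by exists 0; split; rewrite ?mul0n //; move=> x y []; lia.
  have [a [a0 ia ai Fa Fpre]] := IHi (ltnW iK).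
  have [j jK lane] := lanes i iK.
  have jw : (j * r + r <= w)%N by rewrite -mulSnr /w leq_mul2r jK orbT.
  have iS : (i * w + w <= S)%N by rewrite -mulSnr SE leq_mul2r iK orbT.
  have Fst := @strip i a (i * w + j * r + r)%N%:Z (ltnW iK) a0 ia.
  have {}Fst : forall x y, in_rect a (i * w + j * r + r)%N%:Z 0 S%:Z x y ->
      ~ clo x y -> F x y.
    apply: Fst => //; try lia.
    move=> x y [xx yy] cl; apply: contrapT => xr.
    by apply: (lane x y) => //; split; lia.
  have Fall x y : in_rect 0 (i * w + j * r + r)%N%:Z 0 S%:Z x y ->
      ~ clo x y -> F x y.
    case=> xx yy ncl; have [ax|xa] := leP a x.
      by apply: Fst => //; split; lia.
    by apply: Fpre => //; split; lia.
  exists (i * w + j * r + r)%N%:Z; split=> //; try (rewrite mulSnr; lia); try lia.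
  move=> y yy; apply: Fall; first by split; lia.
  by apply: lane; split; lia.
have [a [a0 ia ai Fa Fpre]] := prefix (K * m)%N (leqnn _).
move=> x y [xx yy] ncl; have [ax|xa] := leP a x; last first.
  by apply: Fpre => //; split; lia.
apply: (@strip (K * m)%N a S%:Z) => //; try (by rewrite SE; lia); last by split; lia.
move=> u v [uu vv] cl.
by have [|_ ? _ _] := bdry u v _ cl; first by split; lia.
Qed.

(** * Finite product measures *)

Definition is_law (R : realFieldType) (T : finType) (mu : T -> R) : Prop :=
  (forall t, 0 <= mu t) /\ \sum_t mu t = 1.

(** The probability of an event under the product measure with marginal [mu] over
the finite index set [J]. Events are arbitrary propositions, so that the
geometric conditions need not be made boolean. *)
Definition prodpr (R : realFieldType) (T J : finType) (mu : T -> R)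
    (e : {ffun J -> T} -> Prop) : R :=
  \sum_(f | `[< e f >]) \prod_j mu (f j).

Section FiniteProduct.
Variables (R : realFieldType) (T J : finType) (mu : T -> R).
Hypothesis mu_law : is_law mu.
Implicit Types e : {ffun J -> T} -> Prop.

Let w_ge0 (f : {ffun J -> T}) : 0 <= \prod_j mu (f j).
Proof. by apply: prodr_ge0 => j _; apply: mu_law.1. Qed.

Lemma prodpr_ge0 e : 0 <= prodpr mu e.
Proof. by apply: sumr_ge0. Qed.

Lemma prodpr_le e e' : (forall f, e f -> e' f) -> prodpr mu e <= prodpr mu e'.
Proof.
move=> ee'; rewrite /prodpr [leRHS](bigID (fun f => `[< e f >])) /=.
rewrite -[leLHS]addr0 lerD ?sumr_ge0 // le_eqVlt; apply/orP; left; apply/eqP.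
apply: eq_bigl => f; apply/asboolP/andP => [ef|[_ /asboolP//]].
by split; apply/asboolP => //; apply: ee'.
Qed.

Lemma prodpr_eq e e' : (forall f, e f <-> e' f) -> prodpr mu e = prodpr mu e'.
Proof. by move=> ee'; apply: eq_bigl => f; apply: asbool_equiv_eq. Qed.

Lemma prodpr_union (I : finType) e (e' : I -> {ffun J -> T} -> Prop) :
  (forall f, e f -> exists i, e' i f) ->
  prodpr mu e <= \sum_i prodpr mu (e' i).
Proof.
move=> ee'; rewrite /prodpr.
under [leRHS]eq_bigr do rewrite big_mkcond.
rewrite exchange_big /= big_mkcond; apply: ler_sum => f _.
case: asboolP => [/ee'[i ei]|_]; last by apply: sumr_ge0 => i _; case: ifP.
rewrite (bigD1 i) //= ifT; last by apply/asboolP.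
by rewrite lerDl sumr_ge0 // => j _; case: ifP.
Qed.

Lemma prodpr_unionU e e1 e2 : (forall f, e f -> e1 f \/ e2 f) ->
  prodpr mu e <= prodpr mu e1 + prodpr mu e2.
Proof.
move=> ee; have := @prodpr_union bool e (fun b => if b then e1 else e2).
rewrite big_bool; apply => f /ee[] h; by [exists true|exists false].
Qed.

(** The basic product formula, which is distributivity of the product over the sum. *)
Lemma prodpr_cyl (A : J -> pred T) :
  prodpr mu (fun f => forall j, A j (f j)) = \prod_j \sum_(t | A j t) mu t.
Proof.
rewrite bigA_distr_big_dep /=; apply: eq_bigl => f.
by apply/asboolP/familyP => h j; have := h j; rewrite ?unfold_in.
Qed.

Lemma prodprT : prodpr mu (fun _ : {ffun J -> T} => True) = 1.
Proof.
have := prodpr_cyl (fun _ => predT); rewrite big1; last by move=> _ _; apply: mu_law.2.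
by move=> <-; apply: prodpr_eq.
Qed.

Lemma prodprC e : prodpr mu (fun f => ~ e f) = 1 - prodpr mu e.
Proof.
rewrite -prodprT /prodpr [X in X - _](bigID (fun f => `[< e f >])) /=.
have -> : \sum_(i | `[< True >] && `[< e i >]) \prod_j mu (i j) =
    \sum_(f | `[< e f >]) \prod_j mu (f j).
  by apply: eq_bigl => f; rewrite asboolT.
rewrite addrAC subrr add0r; apply: eq_bigl => f.
by rewrite (asboolT I) /=; apply/asboolP/asboolPn.
Qed.

Lemma prodpr_inj (I : finType) (h : I -> J) (A : I -> pred T) : injective h ->
  prodpr mu (fun f => forall i, A i (f (h i))) = \prod_i \sum_(t | A i t) mu t.
Proof.
move=> hI; pose B j : pred T := fun t => [forall i, (h i == j) ==> A i t].
have -> : prodpr mu (fun f => forall i, A i (f (h i))) =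
    prodpr mu (fun f => forall j, B j (f j)).
  apply: prodpr_eq => f; split=> [fA j|fB i].
    by apply/forallP => i; apply/implyP => /eqP <-.
  by have /forallP/(_ i) := fB (h i); rewrite eqxx.
rewrite prodpr_cyl (bigID (mem (h @: predT))) /= [X in _ * X]big1 => [|j jh].
  rewrite mulr1 big_imset; last by move=> i i' _ _; apply: hI.
  apply: eq_bigr => i _; apply: eq_bigl => t; apply/forallP/idP => [/(_ i)|ti i'].
    by rewrite eqxx.
  by apply/implyP => /eqP /hI ->.
rewrite -[RHS]mu_law.2; apply: eq_bigl => t; apply/forallP => i; apply/implyP => /eqP ij.
by case/negP: jh; apply/imsetP; exists i.
Qed.

Lemma prodpr_perm (s : J -> J) e : injective s ->
  prodpr mu (fun f => e [ffun j => f (s j)]) = prodpr mu e.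
Proof.
move=> sI.
have bij : bijective (fun f : {ffun J -> T} => [ffun j => f (s j)] : {ffun J -> T}).
  exists (fun f : {ffun J -> T} => [ffun j => f (invF sI j)] : {ffun J -> T}) => f; apply/ffunP => j;
  by rewrite !ffunE ?f_invF ?invF_f.
rewrite [RHS](reindex _ (onW_bij _ bij)) /=; apply: eq_bigr => f _.
rewrite (reindex_inj sI); apply: eq_bigr => j _; by rewrite ffunE.
Qed.
End FiniteProduct.

(** * Independent fields and their blocks *)

Definition subsite (b : nat) (o : Z2) (s : 'I_b * 'I_b) : Z2 :=
  (b%:Z * o.1 + (s.1 : nat)%:Z, b%:Z * o.2 + (s.2 : nat)%:Z).

Lemma euclid_uniq (b : nat) (x x' : int) (i i' : 'I_b) :
  b%:Z * x + (i : nat)%:Z = b%:Z * x' + (i' : nat)%:Z -> x = x' /\ i = i'.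
Proof.
move=> e; have ib := ltn_ord i; have ib' := ltn_ord i'.
have xx : x = x'.
  have [h|h|//] := ltgtP x x'.
  - have : b%:Z * (x + 1) <= b%:Z * x' by rewrite ler_wpM2l //; lia.
    by rewrite mulrDr mulr1; lia.
  - have : b%:Z * (x' + 1) <= b%:Z * x by rewrite ler_wpM2l //; lia.
    by rewrite mulrDr mulr1; lia.
by split=> //; apply: val_inj; move: e; rewrite xx /=; lia.
Qed.

Lemma subsite_inj (b : nat) (o o' : Z2) (s s' : 'I_b * 'I_b) :
  subsite o s = subsite o' s' -> o = o' /\ s = s'.
Proof.
case: o o' s s' => [x y] [x' y'] [i j] [i' j'] [] /= /euclid_uniq[-> ->].
by move=> /euclid_uniq[-> ->].
Qed.

Lemma subsite_pair_inj (b : nat) (I : finType) (g : I -> Z2) : injective g ->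
  injective (fun u : I * ('I_b * 'I_b) => subsite (g u.1) u.2).
Proof. by move=> gI [i s] [i' s'] /subsite_inj[/= /gI -> ->]. Qed.

Section Iid.
Variables (d : measure_display) (Omega : measurableType d) (R : realType).
Variable P : probability Omega R.

(** Finite-dimensional distributions over arbitrary finite index types [I]; the
injection [g] picks distinct sites, which makes products over pairs (block,
position in the block) available without any reindexing of finite sets. *)
Definition iid_field (T : finType) (w : T -> R) (Y : Omega -> Z2 -> T) : Prop :=
  (forall o t, measurable [set om | Y om o = t]) /\
  forall (I : finType) (g : I -> Z2) (f : I -> T), injective g ->
    P [set om | forall i, Y om (g i) = f i] = (\prod_i w (f i))%:E.

Lemma iid_field_measurable (T : finType) (w : T -> R) (Y : Omega -> Z2 -> T)
    (I : finType) (g : I -> Z2) (f : I -> T) :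
  iid_field w Y -> measurable [set om | forall i, Y om (g i) = f i].
Proof.
move=> [mY _].
have -> : [set om | forall i, Y om (g i) = f i] =
    \bigcap_(i in [set: I]) [set om | Y om (g i) = f i].
  by apply/seteqP; split=> om /= h i; [move=> _|]; apply: h.
by apply: fin_bigcap_measurable => //; exact: finite_finset.
Qed.

Lemma iid_field1 (T : finType) (w : T -> R) (Y : Omega -> Z2 -> T) o t :
  iid_field w Y -> P [set om | Y om o = t] = (w t)%:E.
Proof.
move=> [_ /(_ unit (fun _ => o) (fun _ => t))].
rewrite big_const card_unit /= mulr1 => <-; last by move=> [] [].
by congr (P _); apply/seteqP; split=> om /= h; [move=> _|apply: h tt].
Qed.

(** Disjoint blocks of an independent identically distributed field are again
independent and identically distributed. This is the only form of independence
that the argument uses, once for the boxes and then at each level of the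
hierarchy of blocks. *)
Lemma iid_block (T T' : finType) (w : T -> R) (Y : Omega -> Z2 -> T) (b : nat)
    (phi : {ffun 'I_b * 'I_b -> T} -> T') :
  iid_field w Y ->
  iid_field (fun t => prodpr w (fun h => phi h = t))
    (fun om o => phi [ffun s => Y om (subsite o s)]).
Proof.
move=> iidY.
pose blocks (I : finType) (f : I -> T') : seq {ffun I -> {ffun 'I_b * 'I_b -> T}} :=
  [seq F <- index_enum _ | [forall i, phi ((F : {ffun _}) i) == f i]].
pose cell (I : finType) (g : I -> Z2) (F : {ffun I -> {ffun 'I_b * 'I_b -> T}}) :=
  [set om | forall u : I * ('I_b * 'I_b), Y om (subsite (g u.1) u.2) = F u.1 u.2].
have split_event (I : finType) (g : I -> Z2) (f : I -> T') :
    [set om | forall i, phi [ffun s => Y om (subsite (g i) s)] = f i] =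
    \bigcup_(F in [set` blocks I f]) cell I g F.
  apply/seteqP; split=> om /=.
    move=> h; exists [ffun i => [ffun s => Y om (subsite (g i) s)]].
      rewrite /= mem_filter mem_index_enum andbT.
      by apply/forallP => i; rewrite ffunE h.
    by move=> u /=; rewrite !ffunE.
  move=> [F /=]; rewrite mem_filter => /andP[/forallP FP _] h i.
  rewrite -(eqP (FP i)); congr phi; apply/ffunP => s; rewrite ffunE.
  exact: (h (i, s)).
have mF (I : finType) (g : I -> Z2) F : measurable (cell I g F).
  exact: (iid_field_measurable (fun u => subsite (g u.1) u.2) (fun u => F u.1 u.2) iidY).
split=> [x t|I g f gI].
  have -> : [set om | phi [ffun s => Y om (subsite x s)] = t] =
      [set om | forall i : unit, phi [ffun s => Y om (subsite x s)] = t].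
    by apply/seteqP; split=> om /= h; [move=> _|apply: h tt].
  rewrite (split_event unit (fun _ => x) (fun _ => t)).
  by apply: fin_bigcup_measurable.
rewrite split_event measure_fin_bigcup //; last first.
  apply/trivIsetP => F F' _ _ /eqP FF'; apply/seteqP; split=> // om [h h'].
  by case: FF'; apply/ffunP => i; apply/ffunP => s; rewrite -(h (i, s)) -(h' (i, s)).
rewrite -fsbig_seq ?filter_uniq ?index_enum_uniq // big_filter.
have PF F : P (cell I g F) = (\prod_i \prod_s w (F i s))%:E.
  rewrite (pair_bigA _ (fun i s => w (F i s))) /=.
  exact: (iidY.2 _ (fun u => subsite (g u.1) u.2) (fun u => F u.1 u.2)
    (subsite_pair_inj gI)).
rewrite (eq_bigr _ (fun F _ => PF F)).
rewrite sumEFin; congr EFin; rewrite /prodpr bigA_distr_big_dep /=.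
apply: eq_bigl => F; apply/forallP/familyP => h i; have := h i.
  by move=> /eqP hi; rewrite unfold_in; apply/asboolP.
by rewrite unfold_in => /asboolP ->.
Qed.
End Iid.

Lemma initial_field_iid (d : measure_display) (Omega : measurableType d)
    (R : realType) (P : probability Omega R) (p q : R)
    (X : Z2 -> {RV P >-> site_state}) :
  polluted_initial_field p q X ->
  iid_field P (site_law p q) (fun om x => X x om).
Proof.
move=> [ind law]; split=> [x t|I g f gI].
  exact: (measurable_funPTI (X x) (Y := [set t])).
pose A x : set site_state := 
  if [pick i | g i == x] is Some i then [set f i] else setT.
have Ag i : A (g i) = [set f i].
  rewrite /A; case: pickP => [j /eqP /gI -> //|/(_ i)]; by rewrite eqxx.
pose J := seq_fset tt (map g (enum I)).
have := ind J A (fun _ => Logic.I).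
have -> : \bigcap_(i in [set` J]) (X i @^-1` A i) = [set om | forall i, X (g i) om = f i].
  apply/seteqP; split=> om /= h.
    move=> i; have := h (g i); rewrite Ag => ->//.
    by rewrite /= seq_fsetE map_f // mem_enum.
  move=> x /=; rewrite seq_fsetE => /mapP[i _ ->].
  by rewrite Ag /= h.
move=> ->.
rewrite (perm_big (map g (enum I))); last first.
  apply: perm_trans; first exact: seq_fset_perm.
  by rewrite undup_id // map_inj_uniq ?enum_uniq.
rewrite big_map big_enum /= -prodEFin; apply: eq_bigr => i _.
by rewrite Ag; exact: law.
Qed.

(** * Hierarchy of blocks: propagation *)

(** [None] is a bad block, [Some true] a block known to contain a source of
occupation that spreads through it, and [Some false] a good block without such
a source. *)
Definition status := option bool.

Definition coarse_status (f : {ffun 'I_3 * 'I_3 -> status}) : status :=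
  if [exists i, exists j, [&& i != j, f i == None & f j == None]] then None
  else Some [exists i, f i == Some true].

Lemma coarse_status_bad (f : {ffun 'I_3 * 'I_3 -> status}) :
  coarse_status f = None <->
  exists i j, [/\ i != j, f i = None & f j = None].
Proof.
rewrite /coarse_status; case: ifPn => [bb|nb]; split=> //.
- move: bb => /fintype.existsP[i /fintype.existsP[j /and3P[ij /eqP fi /eqP fj]]] _.
  by exists i, j.
- move=> [i [j [ij fi fj]]]; case/negP: nb.
  by apply/fintype.existsP; exists i; apply/fintype.existsP; exists j; rewrite ij fi fj.
Qed.

Definition adjacent (o o' : Z2) : Prop :=
  (o.2 = o'.2 /\ (o'.1 = o.1 + 1 \/ o.1 = o'.1 + 1)) \/
  (o.1 = o'.1 /\ (o'.2 = o.2 + 1 \/ o.2 = o'.2 + 1)).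

Definition propagates (Y : Z2 -> status) (Fl : Z2 -> Prop) : Prop :=
  forall o o', adjacent o o' -> Y o <> None -> Y o' <> None -> Fl o -> Fl o'.

(** Nothing can be said about a bad sub-block, hence the restriction to good ones. *)
Definition coarse_filled (Y : Z2 -> status) (Fl : Z2 -> Prop) (o : Z2) : Prop :=
  forall s : 'I_3 * 'I_3, Y (subsite o s) <> None -> Fl (subsite o s).

Lemma ord_chain (n : nat) (Q : 'I_n -> Prop) :
  (forall i j : 'I_n, i.+1 = j :> nat \/ j.+1 = i :> nat -> Q i -> Q j) ->
  forall i j, Q i -> Q j.
Proof.
move=> step i j Qi.
have up (d : nat) (k : 'I_n) : (i + d = k)%N -> Q k.
  elim: d k => [|d IHd] k ik.
    by have -> : k = i by apply: val_inj; rewrite /= -ik addn0.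
  have dn : (i + d < n)%N by have := ltn_ord k; lia.
  by apply: (step (Ordinal dn)); [left => /=; lia|apply: IHd].
have down (d : nat) (k : 'I_n) : (k + d = i)%N -> Q k.
  elim: d k => [|d IHd] k ki.
    by have -> : k = i by apply: val_inj; rewrite /= -ki addn0.
  have dn : (k.+1 < n)%N by have := ltn_ord i; lia.
  by apply: (step (Ordinal dn)); [right => /=; lia|apply: IHd => /=; lia].
by have [ij|ij] := leqP i j; [apply: (up (j - i)%N)|apply: (down (i - j)%N)]; lia.
Qed.

(** A 3 by 3 grid with at most one site removed is connected: some row and some
column are complete, and each remaining site lies in a complete row or in a
complete column. *)
Lemma punctured_grid_connected (bad fl : 'I_3 * 'I_3 -> Prop) :
  (forall s s', bad s -> bad s' -> s = s') ->
  (forall i i' j : 'I_3, i.+1 = i' :> nat \/ i'.+1 = i :> nat ->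
     ~ bad (i, j) -> ~ bad (i', j) -> fl (i, j) -> fl (i', j)) ->
  (forall i j j' : 'I_3, j.+1 = j' :> nat \/ j'.+1 = j :> nat ->
     ~ bad (i, j) -> ~ bad (i, j') -> fl (i, j) -> fl (i, j')) ->
  forall s t, ~ bad s -> fl s -> ~ bad t -> fl t.
Proof.
move=> bad1 colstep rowstep.
pose row i := forall j : 'I_3, ~ bad (i, j); pose col j := forall i : 'I_3, ~ bad (i, j).
have fillrow i j j' : row i -> fl (i, j) -> fl (i, j').
  by move=> ri; apply: (@ord_chain _ (fun j => fl (i, j))) => u v uv; apply: rowstep.
have fillcol i i' j : col j -> fl (i, j) -> fl (i', j).
  by move=> cj; apply: (@ord_chain _ (fun i => fl (i, j))) => u v uv; apply: colstep.
have roworcol i j : ~ bad (i, j) -> row i \/ col j.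
  move=> nb; have [|/existsNP[j' /contrapT bj]] := EM (row i); first by left.
  by right=> i' bi; apply: nb; have [_ <-] := bad1 _ _ bj bi.
have [i0 ri0] : exists i, row i.
  have [|/existsNP[j /contrapT bj]] := EM (row 0); first by exists 0.
  by exists 1 => j' /(bad1 _ _ bj)[].
have [j0 cj0] : exists j, col j.
  have [|/existsNP[i /contrapT bi]] := EM (col 0); first by exists 0.
  by exists 1 => i' /(bad1 _ _ bi)[].
move=> [i j] [i' j'] ns fs nt.
have f00 : fl (i0, j0).
  have [ri|cj] := roworcol _ _ ns.
    by apply: (fillcol i) => //; apply: (fillrow _ j).
  by apply: (fillrow _ j) => //; apply: (fillcol i).
have [ri|cj] := roworcol _ _ nt.
  by apply: (fillrow _ j0) => //; apply: (fillcol i0).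
by apply: (fillcol i0) => //; apply: (fillrow _ j0).
Qed.

Section Coarse.
Variables (Y : Z2 -> status) (Fl : Z2 -> Prop).
Hypothesis prop : propagates Y Fl.
Let Y' o := coarse_status [ffun s => Y (subsite o s)].
Let bad o (s : 'I_3 * 'I_3) := Y (subsite o s) = None.

Let bad1 o : Y' o <> None -> forall s s', bad o s -> bad o s' -> s = s'.
Proof.
move=> nb s s' bs bs'; apply: contrapT => ss'; apply: nb.
apply/coarse_status_bad; exists s, s'; split; rewrite ?ffunE //.
exact/eqP.
Qed.

Let spread o s : Y' o <> None -> ~ bad o s -> Fl (subsite o s) ->
  coarse_filled Y Fl o.
Proof.
move=> nb ns fs t; apply: (@punctured_grid_connected (bad o)
  (fun t => Fl (subsite o t)) (bad1 nb) _ _ s) => //.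
- move=> i i' j ii' n1 n2; apply: prop => //.
  by left; rewrite /=; split=> //; lia.
- move=> i i' j ii' n1 n2; apply: prop => //.
  by right; rewrite /=; split=> //; lia.
Qed.

(** Two adjacent good blocks share three pairs of touching sub-blocks, and at most
two of these pairs are spoiled. The third pair transmits the filling, which
then spreads in the second block by connectedness of the punctured grid. *)
Lemma coarse_propagates : propagates Y' (coarse_filled Y Fl).
Proof.
suff cross (h h' : 'I_3 -> 'I_3 * 'I_3) o o' : injective h -> injective h' ->
    (forall j, adjacent (subsite o (h j)) (subsite o' (h' j))) ->
    Y' o <> None -> Y' o' <> None -> coarse_filled Y Fl o ->
    coarse_filled Y Fl o'.
  have inj1 (i : 'I_3) : injective (fun j : 'I_3 => (i, j)) by move=> ? ? [].
  have inj2 (i : 'I_3) : injective (fun j : 'I_3 => (j, i)) by move=> ? ? [].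
  move=> [x y] [x' y']; rewrite /adjacent /= => -[[->]|[->]] [] ->.
  - by apply: (cross (pair ord_max) (pair 0)) => // j; left; rewrite /=; split=> //; lia.
  - by apply: (cross (pair 0) (pair ord_max)) => // j; left; rewrite /=; split=> //; lia.
  - by apply: (cross (pair^~ ord_max) (pair^~ 0)) => // j; right; rewrite /=; split=> //; lia.
  - by apply: (cross (pair^~ 0) (pair^~ ord_max)) => // j; right; rewrite /=; split=> //; lia.
move=> hI hI' adj nb nb' Fo.
have [j [nj nj']] : exists j, ~ bad o (h j) /\ ~ bad o' (h' j).
  apply: contrapT => /forallNP H.
  have {}H j : bad o (h j) \/ bad o' (h' j).
    by have /not_andP[/contrapT|/contrapT] := H j; [left|right].
  have b1 i j : bad o (h i) -> bad o (h j) -> i = j.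
    by move=> bi bj; apply: hI; apply: bad1 bi bj.
  have b2 i j : bad o' (h' i) -> bad o' (h' j) -> i = j.
    by move=> bi bj; apply: hI'; apply: bad1 bi bj.
  have d01 : (0 : 'I_3) <> 1 by [].
  have d02 : (0 : 'I_3) <> ord_max by [].
  have d12 : (1 : 'I_3) <> ord_max by [].
  by case: (H 0) (H 1) (H ord_max) => h0 [] h1 [] h2;
    first [by have := b1 _ _ h0 h1|by have := b1 _ _ h0 h2|by have := b1 _ _ h1 h2
          |by have := b2 _ _ h0 h1|by have := b2 _ _ h0 h2|by have := b2 _ _ h1 h2].
apply: (spread nb' nj'); apply: (prop (adj j)) => //.
exact: Fo.
Qed.

Lemma coarse_ignites : (forall o, Y o = Some true -> Fl o) ->
  forall o, Y' o = Some true -> coarse_filled Y Fl o.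
Proof.
move=> ign o Yo.
have nb : Y' o <> None by rewrite Yo.
move: Yo; rewrite /Y' /coarse_status; case: ifP => // _ [] /fintype.existsP[s].
rewrite ffunE => /eqP ch; apply: (spread (s := s) nb).
  by rewrite /bad ch.
exact: ign.
Qed.
End Coarse.

(** * Hierarchy of blocks: probabilities *)

Lemma prodpr_points (R : realFieldType) (T J : finType) (mu : T -> R)
    (s : seq (J * T)) : is_law mu -> uniq (unzip1 s) ->
  prodpr mu (fun f => forall u, u \in s -> f u.1 = u.2) = \prod_(u <- s) mu u.2.
Proof.
move=> lmu us; pose h (i : 'I_(size s)) := (tnth (in_tuple s) i).1.
have hE i : h i = tnth (map_tuple fst (in_tuple s)) i by rewrite tnth_map.
have hI : injective h.
  by move=> i j; rewrite !hE; apply/tuple_uniqP.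
have := prodpr_inj lmu (fun i => pred1 (tnth (in_tuple s) i).2) hI.
under [X in _ = X]eq_bigr do rewrite big_pred1_eq.
move=> cyl; rewrite big_tnth -cyl; apply: prodpr_eq => f; split=> [fs i|fs u].
  by apply/eqP; apply: fs; apply: mem_tnth.
by move=> /(tnthP (in_tuple s))[i ->]; apply/eqP; exact: (fs i).
Qed.

Lemma image_law (R : realFieldType) (T T' J : finType) (mu : T -> R)
    (phi : {ffun J -> T} -> T') :
  is_law mu -> is_law (fun t => prodpr mu (fun f => phi f = t)).
Proof.
move=> lmu; split=> [t|]; first exact: prodpr_ge0.
rewrite -(@prodprT _ _ J _ lmu) /prodpr [RHS](partition_big phi predT) //=.
apply: eq_bigr => t _; apply: eq_bigl => f; rewrite (asboolT Logic.I) /=.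
by apply/asboolP/eqP.
Qed.

Section CoarseLaw.
Variables (R : realFieldType) (w : status -> R).
Hypothesis lw : is_law w.
Let w' t := prodpr w (fun f => coarse_status f = t).

(** A bad block has two distinct bad sub-blocks, and there are 81 ordered pairs. *)
Lemma coarse_bad_le : w' None <= 81 * w None ^+ 2.
Proof.
have := @prodpr_union _ _ _ w lw (('I_3 * 'I_3) * ('I_3 * 'I_3))%type
  (fun f => coarse_status f = None)
  (fun ij f => ij.1 != ij.2 /\ forall u, u \in [:: (ij.1, None); (ij.2, None)] -> f u.1 = u.2).
move/(_ _)/le_trans; apply.
  move=> f /coarse_status_bad[i [j [ij fi fj]]]; exists (i, j); split=> // u.
  by rewrite !inE => /orP[] /eqP ->.
apply: (@le_trans _ _ (\sum_(ij : ('I_3 * 'I_3) * ('I_3 * 'I_3)) w None ^+ 2)).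
  apply: ler_sum => -[i j] _ /=; have [->|ij] := eqVneq i j.
    rewrite /prodpr big_pred0 ?exprn_ge0 ?lw.1 // => f.
    by apply/asboolP => -[].
  apply: (@le_trans _ _ (prodpr w (fun f => forall u, u \in [:: (i, None); (j, None)] -> f u.1 = u.2))).
    by apply: prodpr_le => // f [].
  by rewrite prodpr_points //= ?big_cons ?big_nil ?mulr1 // inE ij.
by rewrite sumr_const card_prod !card_prod !card_ord -[leLHS]mulr_natl.
Qed.

(** A block inherits a source from its first sub-block unless two other sub-blocks
are bad. This lower bound keeps the probability of a source away from zero
while it is still far smaller than the probability of being bad. *)
Lemma coarse_charged_ge :
  w (Some true) * (1 - 81 * w None ^+ 2) <= w' (Some true).
Proof.
pose ch (f : {ffun 'I_3 * 'I_3 -> status}) := f (0, 0) = Some true.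
have pch : prodpr w ch = w (Some true).
  have := @prodpr_points _ _ _ w [:: ((0, 0) : 'I_3 * 'I_3, Some true)] lw isT.
  rewrite big_cons big_nil mulr1 => <-; apply: prodpr_eq => f; split.
    by move=> c u; rewrite inE => /eqP ->.
  by move=> c; apply: (c (_, _)); rewrite inE.
have : prodpr w ch <= w' (Some true) +
    \sum_(ij : ('I_3 * 'I_3) * ('I_3 * 'I_3)) w (Some true) * w None ^+ 2.
  apply: (@le_trans _ _ (w' (Some true) +
      prodpr w (fun f => ch f /\ coarse_status f = None))).
    apply: prodpr_unionU => // f chf; case E : (coarse_status f) => [b|]; last by right.
    left; move: E; rewrite /coarse_status; case: ifP => // _ [<-].
    by congr Some; apply/fintype.existsP; exists (0, 0); apply/eqP.
  rewrite lerD2l; apply: (le_trans (prodpr_union lw (e' := fun ij f => [/\ ij.1 != ij.2,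
     (0, 0) != ij.1, (0, 0) != ij.2 &
     forall u, u \in [:: ((0, 0), Some true); (ij.1, None); (ij.2, None)] -> f u.1 = u.2]) _)).
    move=> f [chf /coarse_status_bad[i [j [ij fi fj]]]]; exists (i, j).
    have ne k : f k = None -> (0, 0) != k.
      by move=> fk; apply/eqP => k0; move: chf; rewrite /ch k0 fk.
    split; rewrite ?ne // => u.
    by rewrite !inE => /or3P[] /eqP ->.
  apply: ler_sum => -[i j] _ /=.
  have [/and3P[ij i0 j0]|nij] := boolP [&& i != j, (0, 0) != i & (0, 0) != j].
    apply: (@le_trans _ _ (prodpr w (fun f => forall u,
        u \in [:: ((0, 0), Some true); (i, None); (j, None)] -> f u.1 = u.2))).
      by apply: prodpr_le => // f [].
    rewrite prodpr_points //= ?big_cons ?big_nil ?mulr1 ?expr2 //.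
    by rewrite !inE negb_or i0 j0 ij.
  rewrite /prodpr big_pred0 ?mulr_ge0 ?exprn_ge0 ?lw.1 // => f.
  by apply/asboolP => -[ij i0 j0 _]; case/negP: nij; apply/and3P.
rewrite pch sumr_const !card_prod !card_ord -[X in _ <= _ + X]mulr_natl.
move: (w _) (w' _) (w _) => a b c /=; lra.
Qed.

(** A good block without a source has none in two given sub-blocks. The square is
enough for contraction, since a source has probability bounded below. *)
Lemma coarse_uncharged_le :
  1 - w' (Some true) <= w' None + (1 - w (Some true)) ^+ 2.
Proof.
rewrite -(prodprC lw).
apply: (le_trans (prodpr_unionU lw (e1 := fun f => coarse_status f = None)
  (e2 := fun f => forall b : bool, predC1 (Some true) (f ((0, if b then 0 else 1) : 'I_3 * 'I_3))) _)).
  move=> f nch; case E : (coarse_status f) => [b|]; [right|by left].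
  move=> b'; apply/eqP => ch; apply: nch; move: E.
  rewrite /coarse_status; case: ifP => // _ _; congr Some.
  by apply/fintype.existsP; eexists; apply/eqP; exact: ch.
rewrite lerD2l (@prodpr_inj _ _ _ w lw bool (fun b => (0, if b then 0 else 1) : 'I_3 * 'I_3)
   (fun _ => predC1 (Some true))); last by move=> [] [].
rewrite big_bool /= -expr2.
have -> : \sum_(t | t != Some true) w t = 1 - w (Some true) => //.
by rewrite -lw.2 [in RHS](bigD1 (Some true)) //= addrAC subrr add0r.
Qed.
End CoarseLaw.

Section GeometricSequence.
Import numFieldNormedType.Exports.

Lemma expr_small (R : realType) (r e : R) : 0 <= r < 1 -> 0 < e ->
  exists n : nat, r ^+ n <= e.
Proof.
move=> /andP[r0 r1] e0.
have r1' : `|r| < 1 by rewrite ger0_norm.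
have /cvgrPdist_le/(_ e e0)[n _ /(_ n (leqnn _))] := cvg_expr r1'.
rewrite /= sub0r normrN ger0_norm; last exact: exprn_ge0.
by exists n.
Qed.
End GeometricSequence.

(** Under these recursions blocks with a source eventually dominate. Here [th k] is
the probability of a bad block and [sg k] that of a block with a source. The
[th k] are at least halved at each step, so that [sg k] never falls below half
of [sg 0]; therefore [1 - sg k + 2 * th k] contracts geometrically. *)
Lemma charged_limit (R : realType) (th sg : nat -> R) (e : R) :
  (forall k, 0 <= th k) -> (forall k, 0 <= sg k <= 1) ->
  (forall k, th k.+1 <= 81 * th k ^+ 2) ->
  (forall k, sg k * (1 - 81 * th k ^+ 2) <= sg k.+1) ->
  (forall k, 1 - sg k.+1 <= th k.+1 + (1 - sg k) ^+ 2) ->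
  162 * th 0 <= 1 -> 0 < sg 0 -> 0 < e ->
  exists n, 1 - sg n <= e /\ \sum_(k < n) th k <= 2 * th 0.
Proof.
move=> th0 sg01 thS sgS uS th0_le sg0 e0.
have th_half k : 2 * th k.+1 <= th k /\ th k <= th 0.
  elim: k => [|k [IH1 IH2]]; split=> //.
  - by have := thS 0; have := th0 0; nra.
  - by have := thS k.+1; have := th0 k.+1; have := th0 k; nra.
  - by have := th0 k.+1; lra.
have sum_le n : \sum_(k < n) th k <= 2 * (th 0 - th n).
  elim: n => [|n IH]; first by rewrite big_ord0 subrr mulr0.
  by rewrite big_ord_recr /=; have := (th_half n).1; lra.
have sg_ge k : sg 0 * (1 - th 0 + th k) <= sg k.
  elim: k => [|k IH]; first by rewrite subrK mulr1.
  apply: le_trans (sgS k); have [h1 h2] := th_half k.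
  have tk := th0 k; have tk1 := th0 k.+1.
  have h : 81 * th k ^+ 2 <= th k / 2 by nra.
  apply: (@le_trans _ _ (sg 0 * (1 - th 0 + th k) * (1 - th k / 2))); last first.
    apply: ler_pM => //; [|lra|lra].
    by apply: mulr_ge0; [exact: ltW|have := th0 0; lra].
  rewrite -mulrA ler_wpM2l //; first exact: ltW.
  nra.
(* The first entry is the contraction rate of the squared term, and 3 / 4 is the
   rate at which [(1 + 2) * th k.+1] is absorbed by [2 * th k]. *)
pose r := Num.max (1 - sg 0 / 2) (3 / 4).
have r1 : r < 1 by rewrite gt_max; apply/andP; split; lra.
have r34 : 3 / 4 <= r by rewrite le_max lexx orbT.
have rs : 1 - sg 0 / 2 <= r by rewrite le_max lexx.
have v_le k : 1 - sg k + 2 * th k <= r ^+ k * 3.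
  elim: k => [|k IH].
    by rewrite expr0; have := th0 0; lra.
  have [h1 h2] := th_half k; have := uS k; have := sg_ge k.
  have tk := th0 k; have /andP[s0 s1] := sg01 k.
  move=> sgk u.
  have h3 : sg 0 / 2 <= sg k by nra.
  have h4 : (1 - sg k) ^+ 2 <= r * (1 - sg k) by rewrite expr2 ler_wpM2r //; lra.
  apply: (@le_trans _ _ (r * (1 - sg k + 2 * th k))); first by nra.
  by rewrite exprS -mulrA ler_wpM2l //; lra.
have [n rn] : exists n, r ^+ n <= e / 3.
  by apply: expr_small; [apply/andP; split; lra|lra].
exists n; split; first by have := v_le n; have := th0 n; lra.
by have := sum_le n; have := th0 n; lra.
Qed.

(** * Dynamics of boxes *)

(** Outside the box the value is never inspected; [Open] is an arbitrary choice. *)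
Definition extend_box (S : nat) (f : {ffun 'I_S * 'I_S -> site_state})
    (x y : int) : site_state :=
  match x, y with
  | Posz a, Posz b =>
    match (insub a : option 'I_S), (insub b : option 'I_S) with
    | Some i, Some j => f (i, j)
    | _, _ => Open
    end
  | _, _ => Open
  end.

Lemma extend_box_ord (S : nat) (f : {ffun 'I_S * 'I_S -> site_state})
    (i j : 'I_S) : extend_box f (i : nat)%:Z (j : nat)%:Z = f (i, j).
Proof. by rewrite /extend_box !valK. Qed.

Lemma in_box_ord (S : nat) (x y : int) : in_rect 0 S%:Z 0 S%:Z x y ->
  exists i j : 'I_S, x = (i : nat)%:Z /\ y = (j : nat)%:Z.
Proof.
case=> xx yy; have ia : (`|x| < S)%N by lia.
have jb : (`|y| < S)%N by lia.
by exists (Ordinal ia), (Ordinal jb); rewrite /=; lia.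
Qed.

Definition box_side (r K m : nat) : nat := (K * (m * (K * r)))%N.

(** The four ways to look at a box, so that growth from the left, from the right,
from below and from above all become growth from the left. *)
Definition box_symmetry (S : nat) (b : bool * bool) (s : 'I_S * 'I_S) :
    'I_S * 'I_S :=
  let i := if b.2 then rev_ord s.1 else s.1 in
  if b.1 then (s.2, i) else (i, s.2).

Definition box_symmetry_inv (S : nat) (b : bool * bool) (s : 'I_S * 'I_S) :
    'I_S * 'I_S :=
  let t := if b.1 then (s.2, s.1) else s in
  (if b.2 then rev_ord t.1 else t.1, t.2).

Lemma box_symmetryK (S : nat) (b : bool * bool) :
  cancel (@box_symmetry S b) (@box_symmetry_inv S b).
Proof.
by case: b => -[] [] [i j]; rewrite /box_symmetry /box_symmetry_inv /= ?rev_ordK.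
Qed.

Lemma box_symmetry_invK (S : nat) (b : bool * bool) :
  cancel (@box_symmetry_inv S b) (@box_symmetry S b).
Proof.
by case: b => -[] [] [i j]; rewrite /box_symmetry /box_symmetry_inv /= ?rev_ordK.
Qed.

Definition box_good (r K m : nat)
    (f : {ffun 'I_(box_side r K m) * 'I_(box_side r K m) -> site_state}) : Prop :=
  directed_good r K m (fun x y => extend_box f x y = Closed)
                      (fun x y => extend_box f x y = Occupied).

Definition box_status (r K m : nat)
    (f : {ffun 'I_(box_side r K m) * 'I_(box_side r K m) -> site_state}) : status :=
  if `[< forall s, f s = Occupied >] then Some true
  else if `[< forall b, box_good [ffun s => f (box_symmetry b s)] >]
  then Some false else None.

Definition site_growth_closed (c : configuration) (F : Z2 -> Prop) : Prop :=
  (forall x, c x = Occupied -> F x) /\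
  (forall x, c x <> Closed -> F (x + e1) \/ F (x - e1) ->
     F (x + e2) \/ F (x - e2) -> F x).

Lemma eventually_occupied_growth_closed (c : configuration) :
  site_growth_closed c (eventually_occupied c).
Proof.
have stay x t : iter t step c x = Occupied -> iter t.+1 step c x = Occupied.
  by move=> h; rewrite /= /step h.
have stays x t u : iter t step c x = Occupied -> iter (u + t) step c x = Occupied.
  by move=> h; elim: u => // u; rewrite addSn; exact: stay.
split=> [x cx|x ncx [[t1 h1]|[t1 h1]] [[t2 h2]|[t2 h2]]]; first by exists 0%N.
all: have := stays _ _ t2 h1; have := stays _ _ t1 h2; rewrite [(t1 + t2)%N]addnC;
  set t := (t2 + t1)%N => {}h2 {}h1;
  have : iter t step c x <> Closed
    by elim: t {h1 h2} => // t IH; rewrite /= /step; case: ifP.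
all: case E : (iter t step c x) => // _; first by exists t.
all: exists t.+1; by rewrite /= /step E h1 h2 /= ?orbT.
Qed.

Section BoxDynamics.
Variables (r K m : nat) (c : configuration) (F : Z2 -> Prop).
Hypotheses (r0 : (0 < r)%N) (K0 : (0 < K)%N) (m0 : (0 < m)%N).
Hypothesis gc : site_growth_closed c F.
Let S := box_side r K m.
Let conf (o : Z2) := [ffun s : 'I_S * 'I_S => c (subsite o s)].
Let stat (o : Z2) := box_status (conf o).

Definition box_filled (o : Z2) : Prop :=
  forall s : 'I_S * 'I_S, c (subsite o s) <> Closed -> F (subsite o s).

Let S0 : (0 < S)%N.
Proof. by rewrite /S /box_side !muln_gt0 K0 m0 r0. Qed.

(** The reason for keeping closed sites away from the border: a filled box offers a
complete filled side to each of its neighbours. *)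
Lemma box_boundary_not_closed (o : Z2) (s : 'I_S * 'I_S) : stat o <> None ->
  [\/ s.1 = 0%N :> nat, s.1.+1 = S | s.2 = 0%N :> nat \/ s.2.+1 = S] ->
  c (subsite o s) <> Closed.
Proof.
rewrite /stat /box_status; case: asboolP => [occ _ _|_].
  by have := occ s; rewrite ffunE => ->.
case: asboolP => // good _ bd cl.
have [_ bdry _ _] := good (false, false).
have [||h1 h2 h3 h4] := bdry (s.1 : nat)%:Z (s.2 : nat)%:Z.
- by split; have := ltn_ord s.1; have := ltn_ord s.2; rewrite -/(box_side r K m) -/S; lia.
- by rewrite extend_box_ord !ffunE; case: (s) cl.
- by move: h2 h4; rewrite -/(box_side r K m) -/S; case: bd => [||[]]; lia.
Qed.

Let pos (b : bool * bool) (o : Z2) (x y : int) : Z2 :=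
  let x' := if b.2 then S%:Z - 1 - x else x in
  if b.1 then (S%:Z * o.1 + y, S%:Z * o.2 + x') else (S%:Z * o.1 + x', S%:Z * o.2 + y).

Let pos_ord b o (i j : 'I_S) :
  pos b o (i : nat)%:Z (j : nat)%:Z = subsite o (box_symmetry b (i, j)).
Proof.
have iS := ltn_ord i.
by case: b => -[] []; rewrite /pos /subsite /box_symmetry /=; congr (_, _); lia.
Qed.

Let neighbour_filled b o : stat o <> None ->
  (forall y, 0 <= y < S%:Z -> F (pos b o (- 1) y)) -> box_filled o.
Proof.
rewrite /stat /box_status; case: asboolP => [occ _ _|_].
  by move=> s _; apply: gc.1; have := occ s; rewrite ffunE.
case: asboolP => // good _ left.
suff fill (i j : 'I_S) : c (subsite o (box_symmetry b (i, j))) <> Closed ->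
    F (subsite o (box_symmetry b (i, j))).
  by move=> s; rewrite -[s](box_symmetry_invK b) [box_symmetry_inv b s]surjective_pairing; exact: fill.
have posE x y : in_rect 0 S%:Z 0 S%:Z x y ->
    extend_box [ffun s => conf o (box_symmetry b s)] x y = c (pos b o x y).
  move=> /in_box_ord[u [v [-> ->]]]; by rewrite extend_box_ord !ffunE pos_ord.
have ij_box : in_rect 0 S%:Z 0 S%:Z (i : nat)%:Z (j : nat)%:Z.
  by split; have := ltn_ord i; have := ltn_ord j; lia.
rewrite -pos_ord => ncl.
have moved (u v w w' : Z2) : (u = w /\ v = w') \/ (u = w' /\ v = w) ->
    F u \/ F v -> F w \/ F w'.
  by move=> [] [-> ->] []; [left|right|right|left].
have Z2_eq (u v : Z2) : u.1 = v.1 -> u.2 = v.2 -> u = v.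
  by case: u v => [? ?] [? ?] /= -> ->.
apply: (directed_fill r0 K0 m0 (good b) (F := fun x y => F (pos b o x y))) => //.
  split=> x y xy; rewrite posE //; first exact: gc.1.
  move=> nc Fh Fv; apply: gc.2 => //.
  - case: (b) Fh Fv => -[] [] Fh Fv; [move: Fv|move: Fv|move: Fh|move: Fh];
      apply: moved; rewrite /pos /e1 /=;
      first [by left; split; apply: Z2_eq => /=; lia|by right; split; apply: Z2_eq => /=; lia].
  - case: (b) Fh Fv => -[] [] Fh Fv; [move: Fh|move: Fh|move: Fv|move: Fv];
      apply: moved; rewrite /pos /e2 /=;
      first [by left; split; apply: Z2_eq => /=; lia|by right; split; apply: Z2_eq => /=; lia].
by rewrite posE.
Qed.
Lemma box_propagates : propagates stat box_filled.
Proof.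
move=> [x1 x2] [x1' x2'] adj nb nb' Fo.
have edge (i j : 'I_S) :
    [\/ i = 0%N :> nat, i.+1 = S | j = 0%N :> nat \/ j.+1 = S] ->
    F (S%:Z * x1 + (i : nat)%:Z, S%:Z * x2 + (j : nat)%:Z).
  by move=> bd; apply: (Fo (i, j)); exact: (@box_boundary_not_closed _ (i, j) nb bd).
have l0 : (0 < S)%N by [].
have ls : (S.-1 < S)%N by rewrite ltn_predL.
pose o0 := Ordinal l0; pose om := Ordinal ls.
have Feq (u v : Z2) : F v -> u.1 = v.1 -> u.2 = v.2 -> F u.
  by case: u v => [? ?] [? ?] /= Fv -> ->.
case: adj => /= -[e [h|h]]; subst.
- apply: (@neighbour_filled (false, false)) => // y yy; have yS : (`|y| < S)%N by lia.
  apply: (Feq _ _ (edge om (Ordinal yS) _)); rewrite /pos /=; try lia.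
  by apply: Or32; rewrite /=; lia.
- apply: (@neighbour_filled (false, true)) => // y yy; have yS : (`|y| < S)%N by lia.
  apply: (Feq _ _ (edge o0 (Ordinal yS) _)); rewrite /pos /=; try lia.
  by apply: Or31; rewrite /=; lia.
- apply: (@neighbour_filled (true, false)) => // y yy; have yS : (`|y| < S)%N by lia.
  apply: (Feq _ _ (edge (Ordinal yS) om _)); rewrite /pos /=; try lia.
  by apply: Or33; rewrite /=; lia.
- apply: (@neighbour_filled (true, true)) => // y yy; have yS : (`|y| < S)%N by lia.
  apply: (Feq _ _ (edge (Ordinal yS) o0 _)); rewrite /pos /=; try lia.
  by apply: Or33; rewrite /=; lia.
Qed.

Fixpoint level_status (k : nat) (o : Z2) : status :=
  if k is k'.+1 then coarse_status [ffun s => level_status k' (subsite o s)]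
  else @box_status r K m [ffun s => c (subsite o s)].

Fixpoint level_filled (k : nat) : Z2 -> Prop :=
  if k is k'.+1 then coarse_filled (level_status k') (level_filled k')
  else box_filled.

Lemma level_propagates (k : nat) :
  propagates (level_status k) (level_filled k) /\
  forall o, level_status k o = Some true -> level_filled k o.
Proof.
elim: k => [|k [prop ign]]; last first.
  split; first exact: coarse_propagates.
  by apply: coarse_ignites.
split; first exact: box_propagates.
move=> o /=; rewrite /box_status; case: asboolP => [occ _|_]; last by case: ifP.
by move=> s _; apply: gc.1; have := occ s; rewrite ffunE.
Qed.

(** The filling of a high level block is passed down to the box that contains the
origin, because every block of the origin is good. The origin is a corner of
its box, hence not closed. *)
Lemma origin_filled (n : nat) :
  (forall k, (k < n)%N -> level_status k (0, 0) <> None) ->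
  level_status n (0, 0) = Some true -> F (0, 0).
Proof.
move=> nb ch; have := (level_propagates n).2 _ ch.
have : forall k, (k <= n)%N -> level_status k (0, 0) <> None.
  by move=> k; rewrite leq_eqVlt => /orP[/eqP ->|/nb //]; rewrite ch.
elim: n {nb ch} => [|n IH] nb Fn.
  have <- : subsite (0, 0) (Ordinal S0, Ordinal S0) = (0, 0) by rewrite /subsite /= !mulr0.
  apply: Fn; apply: (@box_boundary_not_closed (0, 0) (_, _) (nb 0%N isT)).
  exact: Or31.
have s0 : subsite (0, 0) ((0, 0) : 'I_3 * 'I_3) = (0, 0) by rewrite /subsite /= !mulr0.
apply: IH => [k kn|]; first by apply: nb; lia.
by have := Fn (0, 0); rewrite s0; apply; exact: (nb n (leqnSn n)).
Qed.
End BoxDynamics.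

(** * Reduction to the probability of a bad box *)

Lemma site_law_is_law (R : realType) (p q : R) :
  0 <= p -> 0 <= q -> p + q <= 1 -> is_law (site_law p q).
Proof.
move=> p0 q0 pq; split; first by case=> //=; lra.
rewrite (bigD1 Occupied) //= (bigD1 Closed) //= (bigD1 Open) //= big_pred0.
  by ring.
by case.
Qed.

Definition box_status_law (R : realType) (p q : R) (r K m : nat) (t : status) : R :=
  prodpr (site_law p q) (fun f => @box_status r K m f = t).

Definition level_law (R : realFieldType) (w : status -> R) (k : nat) : status -> R :=
  iter k (fun w t => prodpr w (fun f => coarse_status f = t)) w.

Lemma level_law_law (R : realFieldType) (w : status -> R) (k : nat) :
  is_law w -> is_law (level_law w k).
Proof. by move=> lw; elim: k => //= k IH; exact: image_law. Qed.

Lemma level_status_iid (d : measure_display) (Omega : measurableType d)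
    (R : realType) (P : probability Omega R) (p q : R)
    (X : Z2 -> {RV P >-> site_state}) (r K m k : nat) :
  polluted_initial_field p q X ->
  iid_field P (level_law (box_status_law p q r K m) k)
    (fun om o => level_status r K m (fun x => X x om) k o).
Proof.
move=> fX; elim: k => [|k IH] /=.
  exact: (iid_block (@box_status r K m) (initial_field_iid fX)).
exact: (iid_block coarse_status IH).
Qed.

Lemma law_status (R : realFieldType) (w : status -> R) : is_law w ->
  w None + w (Some false) = 1 - w (Some true).
Proof.
move=> [_ <-]; rewrite (bigD1 None) //= (bigD1 (Some false)) //= (bigD1 (Some true)) //= big_pred0.
  by ring.
by case=> [[]|].
Qed.

(** The event of [origin_filled] has probability close to one: the union bound over
all levels costs twice the probability of a bad box, and a source is present at
a suitable level with probability as close to one as desired, however rare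
completely occupied boxes are. *)
Lemma origin_occupied_ge (d : measure_display) (Omega : measurableType d)
    (R : realType) (P : probability Omega R) (p q e : R)
    (X : Z2 -> {RV P >-> site_state}) (r K m : nat) :
  (0 < r)%N -> (0 < K)%N -> (0 < m)%N ->
  0 < p -> 0 <= q -> p + q <= 1 -> polluted_initial_field p q X ->
  162 * box_status_law p q r K m None <= 1 -> 0 < e ->
  ((1 - (2 * box_status_law p q r K m None + e))%:E <=
    P [set om | eventually_occupied (fun x => X x om) (0, 0)%R])%E.
Proof.
move=> r0 K0 m0 p0 q0 pq fX; set w := box_status_law p q r K m => w162 e0.
have lsite := site_law_is_law (ltW p0) q0 pq.
have lw : is_law w by apply: image_law.
pose th k := level_law w k None; pose sg k := level_law w k (Some true).
have lk k : is_law (level_law w k) by apply: level_law_law.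
have [|||||||n [un sumn]] := @charged_limit R th sg e _ _ _ _ _ _ _ e0.
- by move=> k; apply: (lk k).1.
- move=> k; apply/andP; split; first exact: (lk k).1.
  have := law_status (lk k); have := (lk k).1 None; have := (lk k).1 (Some false).
  rewrite /sg; lra.
- by move=> k; exact: (coarse_bad_le (lk k)).
- by move=> k; exact: (coarse_charged_ge (lk k)).
- by move=> k; exact: (coarse_uncharged_le (lk k)).
- exact: w162.
- rewrite /sg /= /w /box_status_law.
  apply: (@lt_le_trans _ _ (prodpr (site_law p q)
    (fun f : {ffun 'I_(box_side r K m) * 'I_(box_side r K m) -> site_state} =>
       forall s, pred1 Occupied (f s)))).
    rewrite (prodpr_cyl _ (fun _ => pred1 Occupied)); apply: prodr_gt0 => s _.
    by rewrite big_pred1_eq.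
  apply: prodpr_le => // f occ; rewrite /box_status asboolT // => s.
  exact/eqP/occ.
pose lev k om := level_status r K m (fun x => X x om) k (0, 0).
have iid k := level_status_iid r K m k fX.
(* The last two of these events together say that the block of level [n] has no
   source. *)
pose A k := if (k < n)%N then [set om | lev k om = None] else
  if k == n then [set om | lev n om = None] else [set om | lev n om = Some false].
have mA k : measurable (A k).
  by rewrite /A; case: ifP => _; [|case: ifP => _]; exact: (iid _).1.
set ev := [set om | _].
have mev : measurable ev by exact: measurable_eventually_occupied.
have sub : ~` ev `<=` \big[setU/set0]_(k < n.+2) A k.
  move=> om nev; rewrite -bigcup_mkord /=; apply: contrapT => nA; apply: nev.
  have nAk k : (k < n.+2)%N -> ~ A k om by move=> kn Ak; apply: nA; exists k.
  have gc := eventually_occupied_growth_closed (fun x => X x om).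
  apply: (@origin_filled r K m _ _ r0 K0 m0 gc n).
    by move=> k kn; have := nAk k; rewrite /A kn; apply; lia.
  have := nAk n (ltnW (ltnSn n.+1)); have := nAk n.+1 (ltnSn n.+1).
  rewrite /A ltnn eqxx ltnNge leqnSn /= eqn_leq ltnn /= /lev.
  by case: level_status => [[]|].
have Pnev : (P (~` ev) <= (2 * w None + e)%:E)%E.
  apply: (@le_trans _ _ (\sum_(k < n.+2) P (A k))%E).
    apply: (le_trans _ (@Boole_inequality _ _ _ P A n.+2 (fun i _ => mA i))).
    by apply: le_measure => //; rewrite inE; [exact: measurableC|apply: bigsetU_measurable].
  rewrite 2!big_ord_recr /=.
  have PA k : (k < n)%N -> P (A k) = (th k)%:E.
    by move=> kn; rewrite /A kn; exact: (iid_field1 _ _ (iid k)).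
  rewrite (eq_bigr (fun k : 'I_n => (th k)%:E)) => [|k _]; last exact: PA.
  rewrite sumEFin.
  have -> : P (A n) = (level_law w n None)%:E.
    by rewrite /A ltnn eqxx; exact: (iid_field1 _ _ (iid n)).
  have -> : P (A n.+1) = (level_law w n (Some false))%:E.
    by rewrite /A ltnNge leqnSn /= eqn_leq ltnn /=; exact: (iid_field1 _ _ (iid n)).
  rewrite -!EFinD lee_fin; have := law_status (lk n); move: un sumn; rewrite /th /sg /=.
  by move: (\sum_(k < n) _) => s; lra.
have -> : P ev = (1 - P (~` ev))%E.
  by rewrite -(setCK ev) probability_setC ?setCK //; exact: measurableC.
by rewrite EFinB leeB.
Qed.

(** * Defects of a box *)

(** The union bound in the form used for all defects of a box: for each candidate
[n], a pattern of distinct sites [z] with [rel n i z] is prescribed, and the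
value at the site of index [i] must satisfy [A i]. *)
Lemma prodpr_pattern (R : realFieldType) (T J N I : finType) (mu : T -> R)
    (rel : N -> I -> J -> Prop) (A : I -> pred T) : is_law mu ->
  (forall n i z z', rel n i z -> rel n i z' -> z = z') ->
  (forall n i i' z, rel n i z -> rel n i' z -> i = i') ->
  prodpr mu (fun f => exists n, forall i, exists z, rel n i z /\ A i (f z)) <=
  #|N|%:R * \prod_i \sum_(t | A i t) mu t.
Proof.
move=> lmu func inj.
apply: (le_trans (prodpr_union lmu (e' := fun n f => forall i, exists z, rel n i z /\ A i (f z)) _)) => //.
rewrite mulr_natl -sumr_const; apply: ler_sum => n _.
have [tot|ntot] := EM (forall i, exists z, rel n i z).
  have [h hP] := choice tot.
  have hI : injective h.
    by move=> i i' ii'; apply: (inj n _ _ (h i)) => //; rewrite ii'.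
  rewrite -(prodpr_inj lmu A hI); apply: prodpr_le => // f ex i.
  by have [z [rz Az]] := ex i; rewrite -(func _ _ _ _ rz (hP i)).
rewrite /prodpr [leLHS]big_pred0; last first.
  by move=> f; apply: asboolF => ex; apply: ntot => i; have [z []] := ex i; exists z.
by apply: prodr_ge0 => i _; apply: sumr_ge0 => t _; apply: lmu.1.
Qed.

Lemma quotient_uniq (b x y i j : nat) :
  (x * b + i = y * b + j)%N -> (i < b)%N -> (j < b)%N -> x = y.
Proof.
move=> e ib jb; have b0 : (0 < b)%N by lia.
by have := congr1 (divn^~ b) e; rewrite /= !divnMDl // !divn_small // !addn0.
Qed.

Section BoxBad.
Variables (R : realType) (p q : R) (r K m : nat).
Hypotheses (p0 : 0 <= p) (q0 : 0 <= q) (pq : p + q <= 1).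
Hypotheses (r0 : (0 < r)%N).
Let w := (K * r)%N.
Let l := (m * w)%N.
Let S := box_side r K m.
Let mu := site_law p q.
Let lmu : is_law mu := site_law_is_law p0 q0 pq.
Let J : finType := ('I_S * 'I_S)%type.
Implicit Types f : {ffun J -> site_state}.

Let muC : \sum_(t | pred1 Closed t) mu t = q.
Proof. by rewrite (big_pred1 Closed). Qed.

Let muN : \sum_(t | predC1 Occupied t) mu t = 1 - p.
Proof. by rewrite -lmu.2 [in RHS](bigD1 Occupied) //= addrAC subrr add0r. Qed.

Definition close_pair f : Prop := exists z z' : J,
  [/\ z != z', f z = Closed, f z' = Closed,
      (z.1 <= z'.1 + r)%N /\ (z'.1 <= z.1 + r)%N &
      (z.2 <= z'.2 + r)%N /\ (z'.2 <= z.2 + r)%N].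

Lemma close_pair_le :
  prodpr mu close_pair <= (S * S * (r.*2.+1 * r.*2.+1))%:R * q ^+ 2.
Proof.
pose N : finType := (J * ('I_r.*2.+1 * 'I_r.*2.+1))%type.
pose rel (n : N) (b : bool) (z : J) : Prop := if b then z = n.1 else
  [/\ z != n.1, z.1 + r = n.1.1 + n.2.1 & z.2 + r = n.1.2 + n.2.2]%N.
have := @prodpr_pattern _ _ _ _ _ _ rel (fun _ => pred1 Closed) lmu.
rewrite big_bool muC /= -expr2 !card_prod !card_ord => H.
apply: le_trans (H _ _).
- apply: prodpr_le => // f [z [z' [zz' cz cz' [h1 h2] [h3 h4]]]].
  have a1 : (z'.1 + r - z.1 < r.*2.+1)%N by lia.
  have a2 : (z'.2 + r - z.2 < r.*2.+1)%N by lia.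
  exists (z, (Ordinal a1, Ordinal a2)) => -[]; first by exists z; split=> //; apply/eqP.
  exists z'; split; last exact/eqP.
  by split=> /=; rewrite ?subnKC // eq_sym.
- move=> [z n] [] [u1 u2] [v1 v2] /=; first by move=> -> ->.
  by move=> [_ h1 h2] [_ h3 h4]; congr (_, _); apply: val_inj => /=; lia.
- by move=> n [] [] z //= => [-> [/eqP]|[/eqP ? _ _] ?].
Qed.

Definition near_border f : Prop := exists z : J, f z = Closed /\
  ~ [/\ r <= z.1, z.1 + r < S, r <= z.2 & z.2 + r < S]%N.

Lemma near_border_le : prodpr mu near_border <= (4 * (r * S))%:R * q.
Proof.
pose N : finType := ((bool * bool) * ('I_r * 'I_S))%type.
pose rel (n : N) (_ : unit) (z : J) : Prop :=
  let u := if n.1.1 then (z.2, z.1) else z in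
  (if n.1.2 then (u.1 + n.2.1).+1 = S else u.1 = n.2.1 :> nat) /\ u.2 = n.2.2.
have := @prodpr_pattern _ _ _ _ _ _ rel (fun _ => pred1 Closed) lmu.
rewrite big_const card_unit /= muC mulr1 !card_prod !card_bool !card_ord => H.
apply: le_trans (H _ _).
- apply: prodpr_le => // f [[z1 z2] [cz nb]]; pose z : J := (z1, z2).
  have hS1 := ltn_ord z1; have hS2 := ltn_ord z2.
  have [h|h] := ltnP z1 r.
    by exists ((false, false), (Ordinal h, z2)) => u; exists z; split; [|apply/eqP].
  have [h'|h'] := ltnP z2 r.
    by exists ((true, false), (Ordinal h', z1)) => u; exists z; split; [|apply/eqP].
  have [k|k] := leqP S (z1 + r)%N.
    have a : (S - z1.+1 < r)%N by lia.
    exists ((false, true), (Ordinal a, z2)) => u; exists z; split; last exact/eqP.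
    by split=> //=; lia.
  have [k'|k'] := leqP S (z2 + r)%N.
    have a : (S - z2.+1 < r)%N by lia.
    exists ((true, true), (Ordinal a, z1)) => u; exists z; split; last exact/eqP.
    by split=> //=; lia.
  by case: nb; split.
- move=> [[b1 b2] [a b]] [] [u1 u2] [v1 v2]; rewrite /rel /=.
  case: b1; case: b2 => /= -[h1 h2] [h3 h4]; congr (_, _); apply: val_inj => /=;
  by rewrite ?h2 ?h4 //; lia.
- by move=> n [] [].
Qed.

Definition interior (z : J) : Prop :=
  [/\ r <= z.1, z.1 + r < S, r <= z.2 & z.2 + r < S]%N.

Definition arm_site (D : 'I_3) (z : J) (k : 'I_r) (z' : J) : Prop :=
  if D == 0 then (z'.1 = z.1 + k.+1 :> nat)%N /\ z'.2 = z.2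
  else if D == 1 then (z'.2 = z.2 + k.+1 :> nat)%N /\ z'.1 = z.1
  else (z'.2 + k.+1 = z.2 :> nat)%N /\ z'.1 = z.1.

Definition empty_arm f : Prop := exists D (z : J), [/\ interior z, f z = Closed &
  forall k z', arm_site D z k z' -> f z' <> Occupied].

Lemma empty_arm_le :
  prodpr mu empty_arm <= (3 * (S * S))%:R * (q * (1 - p) ^+ r).
Proof.
pose N : finType := ('I_3 * J)%type.
pose rel (n : N) (i : unit + 'I_r) (z' : J) : Prop :=
  if i is inr k then arm_site n.1 n.2 k z' else z' = n.2.
have := @prodpr_pattern _ _ _ _ _ _ rel
  (fun i => if i is inr _ then predC1 Occupied else pred1 Closed) lmu.
rewrite big_sumType /= big_const card_unit /= muC mulr1.
rewrite (eq_bigr _ (fun _ _ => muN)) prodr_const !card_prod !card_ord => H.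
apply: le_trans (H _ _).
- apply: prodpr_le => // f [D [[z1 z2] [[/= i1 i2 i3 i4] cz arm]]].
  exists (D, (z1, z2)) => -[u|k]; first by exists (z1, z2); split=> //; apply/eqP.
  suff [z' az'] : exists z', arm_site D (z1, z2) k z'.
    by exists z'; split=> //=; apply/eqP; exact: arm az'.
  have kr := ltn_ord k.
  rewrite /arm_site; case: (D == 0) => /=; [|case: (D == 1) => /=].
  + have a : (z1 + k.+1 < S)%N by lia.
    by exists (Ordinal a, z2).
  + have a : (z2 + k.+1 < S)%N by lia.
    by exists (z1, Ordinal a).
  + have a : (z2 - k.+1 < S)%N by lia.
    by exists (z1, Ordinal a); split=> //=; lia.
- move=> [D [z1 z2]] [?|k] [u1 u2] [v1 v2] /=; first by move=> -> ->.
  rewrite /arm_site; case: (D == 0) => /=; [|case: (D == 1) => /=] => /= -[h1 h2] [h3 h4];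
  by congr (_, _); apply: val_inj => /=; rewrite ?h2 ?h4 //; lia.
- move=> [D z] [[]|k] [[]|k'] z' //=; rewrite /arm_site.
  + by move=> ->; case: (D == 0) => /=; [|case: (D == 1) => /=] => -[]; lia.
  + by move=> h zz; move: h; rewrite zz; case: (D == 0) => /=; [|case: (D == 1) => /=] => -[]; lia.
  + case: (D == 0) => /=; [|case: (D == 1) => /=] => -[h1 _] [h2 _]; congr inr; apply: val_inj => /=; lia.
Qed.

Definition no_clear_lane f : Prop := exists i : 'I_(K * m), forall j : 'I_K,
  exists z : J, (i * w + j * r <= z.1 < i * w + j * r + r)%N /\ f z = Closed.

Lemma no_clear_lane_le :
  prodpr mu no_clear_lane <= (K * m)%:R * ((r * S)%:R * q) ^+ K.
Proof.
pose N : finType := ('I_(K * m) * {ffun 'I_K -> 'I_r * 'I_S})%type.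
pose rel (n : N) (j : 'I_K) (z : J) : Prop :=
  (z.1 = n.1 * w + j * r + (n.2 j).1 :> nat)%N /\ z.2 = (n.2 j).2.
have := @prodpr_pattern _ _ _ _ _ _ rel (fun _ => pred1 Closed) lmu.
rewrite (eq_bigr _ (fun _ _ => muC)) prodr_const !card_prod card_ffun card_prod !card_ord.
rewrite natrM natrX -mulrA -exprMn => H.
apply: le_trans (H _ _).
- apply: prodpr_le => // f [i lane]; have [g gP] := choice lane.
  have gr j : ((g j).1 - (i * w + j * r) < r)%N by have [h _] := gP j; lia.
  exists (i, [ffun j => (Ordinal (gr j), (g j).2)]) => j.
  have [/andP[h _] cz] := gP j.
  exists (g j); rewrite /rel /= ffunE /=; split; last exact/eqP.
  by rewrite subnKC.
- move=> [i h] j [u1 u2] [v1 v2]; rewrite /rel /= => -[h1 h2] [h3 h4].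
  by congr (_, _); apply: val_inj => /=; rewrite ?h2 ?h4 //; lia.
- move=> [i h] j j' z; rewrite /rel /= => -[h1 _] [h2 _].
  apply: val_inj; move: h2; rewrite h1 -!addnA => /addnI e.
  by apply: quotient_uniq e _ _.
Qed.

Definition no_clear_block f : Prop := exists i : 'I_(K * m).+1, forall k : 'I_K,
  exists z : J, [/\ (i * w <= z.1 + w)%N, (z.1 < i * w + w)%N,
    (k * l <= z.2 < k * l + l)%N & f z = Closed].

Lemma no_clear_block_le :
  prodpr mu no_clear_block <= (K * m).+1%:R * ((w.*2 * l)%:R * q) ^+ K.
Proof.
pose N : finType := ('I_(K * m).+1 * {ffun 'I_K -> 'I_w.*2 * 'I_l})%type.
pose rel (n : N) (k : 'I_K) (z : J) : Prop :=
  (z.1 + w = n.1 * w + (n.2 k).1 :> nat)%N /\ (z.2 = k * l + (n.2 k).2 :> nat)%N.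
have := @prodpr_pattern _ _ _ _ _ _ rel (fun _ => pred1 Closed) lmu.
rewrite (eq_bigr _ (fun _ _ => muC)) prodr_const !card_prod card_ffun card_prod !card_ord.
rewrite natrM natrX -mulrA -exprMn => H.
apply: le_trans (H _ _).
- apply: prodpr_le => // f [i block]; have [g gP] := choice block.
  have g1 k : ((g k).1 + w - i * w < w.*2)%N by have [? ? ? _] := gP k; lia.
  have g2 (k : 'I_K) : ((g k).2 - k * l < l)%N by have [? ? ? _] := gP k; lia.
  exists (i, [ffun k => (Ordinal (g1 k), Ordinal (g2 k))]) => k.
  have [? ? /andP[? _] cz] := gP k.
  exists (g k); rewrite /rel /= ffunE /=; split; last exact/eqP.
  by rewrite !subnKC.
- move=> [i h] j [u1 u2] [v1 v2]; rewrite /rel /= => -[h1 h2] [h3 h4].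
  by congr (_, _); apply: val_inj => /=; lia.
- move=> [i h] j j' z; rewrite /rel /= => -[_ h1] [_ h2].
  apply: val_inj; move: h2; rewrite h1 => e.
  by apply: quotient_uniq e _ _.
Qed.

Definition empty_column f : Prop := exists (x : 'I_S) (k : 'I_K), forall z : J,
  z.1 = x -> (k * l <= z.2 < k * l + l)%N -> f z <> Occupied.

Lemma empty_column_le :
  prodpr mu empty_column <= (S * K)%:R * (1 - p) ^+ l.
Proof.
pose N : finType := ('I_S * 'I_K)%type.
pose rel (n : N) (b : 'I_l) (z : J) : Prop :=
  z.1 = n.1 /\ (z.2 = n.2 * l + b :> nat)%N.
have := @prodpr_pattern _ _ _ _ _ _ rel (fun _ => predC1 Occupied) lmu.
rewrite (eq_bigr _ (fun _ _ => muN)) prodr_const !card_prod !card_ord => H.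
apply: le_trans (H _ _).
- apply: prodpr_le => // f [x [k col]]; exists (x, k) => b.
  have kS : (k * l + b < S)%N.
    have := ltn_ord k; have := ltn_ord b; rewrite /S /box_side -/w -/l; nia.
  exists (x, Ordinal kS); split=> //; apply/eqP; apply: col => //=.
  by have := ltn_ord b; lia.
- move=> [x k] b [u1 u2] [v1 v2]; rewrite /rel /= => -[h1 h2] [h3 h4].
  by congr (_, _); apply: val_inj => /=; rewrite ?h1 ?h3 //; lia.
- move=> [x k] b b' z; rewrite /rel /= => -[_ h1] [_ h2].
  by apply: val_inj => /=; lia.
Qed.
Lemma box_good_if f :
  ~ close_pair f -> ~ near_border f -> ~ empty_arm f ->
  ~ no_clear_lane f -> ~ no_clear_block f -> ~ empty_column f -> @box_good r K m f.
Proof.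
move=> npair nborder narm nlane nblock ncol.
have inner (i j : 'I_S) : f (i, j) = Closed -> interior (i, j).
  by move=> cl; apply: contrapT => nin; apply: nborder; exists (i, j).
rewrite /box_good /directed_good -/w -/l -/(box_side r K m) -/S.
split; [| | |split].
- move=> x y x' y' /in_box_ord[i [j [-> ->]]] /in_box_ord[i' [j' [-> ->]]].
  rewrite !extend_box_ord => cl cl' h1 h2.
  have [e|/eqP ne] := eqVneq (i, j) (i', j'); first by case: e => -> ->.
  case: npair; exists (i, j), (i', j'); split=> //=; try lia.
  exact/eqP.
- move=> x y /in_box_ord[i [j [-> ->]]]; rewrite extend_box_ord => /inner[/= *].
  by split; lia.
- move=> x y /in_box_ord[i [j [-> ->]]]; rewrite extend_box_ord => cl.
  have arm D : exists k z', arm_site D (i, j) k z' /\ f z' = Occupied.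
    apply: contrapT => H; apply: narm; exists D, (i, j); split=> //; first exact: inner.
    by move=> k z' az' oz'; apply: H; exists k, z'.
  split.
  + have [k [[i' j'] [/= [h1 h2] oz]]] := arm 0.
    move: h1 h2 => /= h1 h2; exists k.+1; split; first by rewrite ltn_ord.
    have -> : (i : nat)%:Z + k.+1%:Z = (i' : nat)%:Z by lia.
    by rewrite -h2 extend_box_ord.
  + have [k [[i' j'] [/= [h1 h2] oz]]] := arm 1.
    move: h1 h2 => /= h1 h2; exists k.+1; split; first by rewrite ltn_ord.
    have -> : (j : nat)%:Z + k.+1%:Z = (j' : nat)%:Z by lia.
    by rewrite -h2 extend_box_ord.
  + have [k [[i' j'] [/= [h1 h2] oz]]] := arm ord_max.
    move: h1 h2 => /= h1 h2; exists k.+1; split; first by rewrite ltn_ord.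
    have -> : (j : nat)%:Z - k.+1%:Z = (j' : nat)%:Z by lia.
    by rewrite -h2 extend_box_ord.
- move=> i iK; apply: contrapT => H; apply: nlane; exists (Ordinal iK) => j.
  apply: contrapT => H'; apply: H; exists j => // x y [xx yy] cl.
  have [|i' [j' [xE yE]]] := @in_box_ord S x y.
    split=> //; have := ltn_ord j; have : (i * w + w <= S)%N.
      by rewrite /S /box_side mulnA -mulSnr leq_mul2r iK orbT.
    have : (j * r + r <= w)%N by rewrite -mulSnr leq_mul2r ltn_ord orbT.
    by move: xx; lia.
  apply: H'; exists (i', j'); split; first by move: xx; rewrite xE /=; lia.
  by move: cl; rewrite xE yE extend_box_ord.
- move=> i; rewrite -ltnS => iK; apply: contrapT => H; apply: nblock.
  exists (Ordinal iK) => k.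
  apply: contrapT => H'; apply: H; exists k => // x y.
  move=> /in_box_ord[i' [j' [-> ->]]] [xx yy]; rewrite extend_box_ord => cl.
  by apply: H'; exists (i', j'); split=> //=; lia.
- move=> x k xx kK; have xS : (`|x| < S)%N by lia.
  apply: contrapT => H; apply: ncol; exists (Ordinal xS), (Ordinal kK).
  move=> [i j] /= -> jk oz; apply: H; exists (j : nat)%:Z; split; first by lia.
  have -> : x = (Ordinal xS : nat)%:Z by rewrite /=; lia.
  by rewrite extend_box_ord.
Qed.

(** The six summands account for two nearby closed sites, a closed site near the
border, a shadow that is too long, a strip without clear lane, a strip boundary
without clear block, and a block with an empty column. *)
Lemma box_bad_le : prodpr mu (fun f => ~ @box_good r K m f) <=
  (S * S * (r.*2.+1 * r.*2.+1))%:R * q ^+ 2 + (4 * (r * S))%:R * q +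
  (3 * (S * S))%:R * (q * (1 - p) ^+ r) +
  (K * m)%:R * ((r * S)%:R * q) ^+ K +
  (K * m).+1%:R * ((w.*2 * l)%:R * q) ^+ K + (S * K)%:R * (1 - p) ^+ l.
Proof.
apply: (@le_trans _ _ (prodpr mu close_pair + prodpr mu near_border +
  prodpr mu empty_arm + prodpr mu no_clear_lane + prodpr mu no_clear_block +
  prodpr mu empty_column)); last first.
  by rewrite !lerD // ?close_pair_le ?near_border_le ?empty_arm_le
     ?no_clear_lane_le ?no_clear_block_le ?empty_column_le.
have U (e1 e2 : {ffun J -> site_state} -> Prop) :
    prodpr mu (fun f => e1 f \/ e2 f) <= prodpr mu e1 + prodpr mu e2.
  exact: prodpr_unionU.
apply: (@le_trans _ _ (prodpr mu (fun f => ((((close_pair f \/ near_border f) \/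
    empty_arm f) \/ no_clear_lane f) \/ no_clear_block f) \/ empty_column f))); last first.
  by do 5![apply: (le_trans (U _ _)); rewrite lerD2r].
apply: prodpr_le => // f ng; apply: contrapT => H; apply: ng.
by apply: box_good_if; tauto.
Qed.

Lemma box_status_bad_le : box_status_law p q r K m None <=
  4 * prodpr mu (fun f => ~ @box_good r K m f).
Proof.
apply: le_trans (prodpr_union lmu (I := (bool * bool)%type)
   (e' := fun b f => ~ @box_good r K m [ffun s => f (box_symmetry b s)]) _) _.
  move=> f; rewrite /box_status; case: asboolP => // _; case: asboolP => // H _.
  exact/existsNP.
rewrite (eq_bigr _ (fun b _ => prodpr_perm mu (fun f => ~ @box_good r K m f)
  (can_inj (box_symmetryK b)))).
by rewrite sumr_const card_prod card_bool -[leLHS]mulr_natl.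
Qed.
End BoxBad.

(** * Asymptotics *)

Lemma nat_above (R : realType) (x : R) : 0 <= x ->
  exists n : nat, [/\ (0 < n)%N, x <= n%:R & n%:R <= x + 1].
Proof.
move=> x0; exists (Num.truncn x).+1; have /andP[h1 h2] := truncn_itv x0.
by split=> //; [exact: ltW|rewrite -natr1 lerD2r].
Qed.

Lemma exprn_onem_le (R : realType) (p : R) (n : nat) : 0 <= p <= 1 ->
  (1 - p) ^+ n <= expR (- (p * n%:R)).
Proof.
move=> /andP[p0 p1]; rewrite -mulNr mulrC expRM_natl.
by rewrite lerXn2r ?nnegrE ?expR_ge0 ?subr_ge0 // expR_ge1Dx.
Qed.

Lemma expR_ge_cube (R : realType) (x : R) : 0 <= x -> x ^+ 3 <= 27 * expR x.
Proof.
move=> x0; have h : x / 3 <= expR (x / 3).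
  by apply: le_trans (expR_ge1Dx _); rewrite lerDr.
have -> : expR x = expR (x / 3) ^+ 3 by rewrite -expRM_natl; congr expR; field.
have h3 : (x / 3) ^+ 3 <= expR (x / 3) ^+ 3.
  by rewrite lerXn2r ?nnegrE ?expR_ge0 ?divr_ge0.
have -> : x ^+ 3 = 27 * (x / 3) ^+ 3 by field.
by rewrite ler_pM2l.
Qed.

Lemma expr_le_expRN (R : realType) (a x : R) (n : nat) :
  0 <= a -> 16 * a <= 1 -> x <= n%:R -> a ^+ n <= expR (- x) ^+ 2.
Proof.
move=> a0 a16 xn.
have h : 1 / 2 <= expR (- (1 / 2)) :> R by apply: le_trans (expR_ge1Dx _); lra.
have ae : a <= expR (- 2).
  have -> : - 2 = 4%:R * (- (1 / 2)) :> R by field.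
  rewrite expRM_natl; apply: (@le_trans _ _ ((1 / 2) ^+ 4)).
    by rewrite -[leLHS]mul1r; lra.
  by rewrite lerXn2r ?nnegrE ?expR_ge0 //; lra.
apply: (@le_trans _ _ (expR (- 2) ^+ n)).
  by rewrite lerXn2r ?nnegrE ?expR_ge0.
rewrite -!expRM_natl ler_expR; lra.
Qed.

(** The six contributions to the probability of a bad box. Here [s] is the density
[q / p ^ 2] of closed sites, and [A], [W], [Lp] and [Sp] are the shadow length,
the strip width, the block height and the box side, all in units of [1 / p]. *)
Section DefectBounds.
Variables (R : realType) (p s x y : R).
Hypotheses (x108 : 108 <= x) (xy : 4 * x ^+ 2 <= y) (s0 : 0 <= s).
Hypothesis density : x ^+ 2 * (y * s) <= (1 / x) ^+ 2.
Let v := 1 / x.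

Let x0 : 0 <= x. Proof. by apply: le_trans x108. Qed.

Let y0 : 0 < y.
Proof. by apply: lt_le_trans xy; rewrite mulr_gt0 // exprn_gt0 // (lt_le_trans _ x108). Qed.

Let xv : x * v = 1.
Proof. by rewrite /v mulrCA divff ?mulr1 // gt_eqF // (lt_le_trans _ x108). Qed.

Let v0 : 0 <= v. Proof. by rewrite divr_ge0. Qed.

Let v2 : 108 * v ^+ 2 <= v.
Proof.
have v108 := ler_wpM2r v0 x108; rewrite xv in v108.
by rewrite expr2 mulrA ler_piMl.
Qed.

Let yv : 4 * x <= v * y.
Proof.
have := ler_wpM2l v0 xy; have -> : v * (4 * x ^+ 2) = 4 * x * (x * v) by ring.
by rewrite xv mulr1.
Qed.

Let xyv : x / y <= v / 4.
Proof.
rewrite ler_pdivrMr // mulrAC ler_pdivlMr //.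
by rewrite mulrC.
Qed.

Lemma pair_bound (A Sp : R) : 0 < p -> p <= A -> A <= 2 * x ->
  0 <= Sp -> Sp <= 6 * (x * y) -> (Sp * (2 * A + p) * s) ^+ 2 <= v.
Proof.
move=> p0 pA Ax Sp0 Sx.
have h : Sp * (2 * A + p) * s <= 36 * (x ^+ 2 * (y * s)).
  apply: (@le_trans _ _ (6 * (x * y) * (6 * x) * s)); last by rewrite le_eqVlt; apply/orP; left; apply/eqP; ring.
  by apply: ler_wpM2r => //; apply: ler_pM => //; lra.
have h0 : 0 <= Sp * (2 * A + p) * s.
  by apply: mulr_ge0 => //; apply: mulr_ge0 => //; lra.
apply: (@le_trans _ _ ((v / 3) ^+ 2)).
  by rewrite lerXn2r ?nnegrE //; [exact: divr_ge0|move: h density v2; rewrite -/v; lra].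
have -> : (v / 3) ^+ 2 = v ^+ 2 / 9 by field.
by have := exprn_ge0 2 v0; have := v2; lra.
Qed.

Lemma shadow_bound (A Sp : R) : 0 <= A -> A <= 2 * x ->
  0 <= Sp -> Sp <= 6 * (x * y) -> A * Sp * s <= v / 9.
Proof.
move=> A0 Ax Sp0 Sx; apply: (@le_trans _ _ (12 * (x ^+ 2 * (y * s)))).
  have -> : 12 * (x ^+ 2 * (y * s)) = 2 * x * (6 * (x * y)) * s by ring.
  by apply: ler_wpM2r => //; apply: ler_pM.
by move: density v2; rewrite -/v; lra.
Qed.

Lemma arm_bound (Sp : R) : 0 <= Sp -> Sp <= 6 * (x * y) ->
  3 * (Sp * Sp * s) / y <= v.
Proof.
move=> Sp0 Sx; rewrite ler_pdivrMr //.
have : Sp * Sp * s <= 36 * (x ^+ 2 * (y * s)) * y.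
  have -> : 36 * (x ^+ 2 * (y * s)) * y = (6 * (x * y)) * (6 * (x * y)) * s by ring.
  by apply: ler_wpM2r => //; apply: ler_pM.
have : (36 * (x ^+ 2 * (y * s))) * y <= (v / 3) * y.
  by apply: ler_wpM2r; [exact: ltW|move: density v2; rewrite -/v; lra].
lra.
Qed.

Lemma block_bound (W Lp : R) : 0 <= W -> W <= 4 * x ^+ 2 ->
  0 <= Lp -> Lp <= 3 * y -> 2 * W * Lp * s <= v / 4.
Proof.
move=> W0 Wx L0 Ly; apply: (@le_trans _ _ (24 * (x ^+ 2 * (y * s)))).
  have -> : 24 * (x ^+ 2 * (y * s)) = 2 * (4 * x ^+ 2) * (3 * y) * s by ring.
  by apply: ler_wpM2r => //; apply: ler_pM => //; [apply: mulr_ge0|rewrite ler_pM2l].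
by move: density v2 (exprn_ge0 2 v0); rewrite -/v; lra.
Qed.

Lemma power_bound (a c : R) (n : nat) : y = expR x -> 0 <= a -> a <= v / 4 ->
  x <= n%:R -> 0 <= c -> c <= 7 * (x * y) -> c * a ^+ n <= 2 * v.
Proof.
move=> yE a0 av xn c0 cx.
have v1 := ler_wpM2r v0 x108; rewrite xv in v1.
have : a ^+ n <= expR (- x) ^+ 2 by apply: expr_le_expRN => //; lra.
have -> : expR (- x) = 1 / y by rewrite expRN -yE mul1r.
move=> h; apply: (@le_trans _ _ (7 * (x * y) * (1 / y) ^+ 2)).
  by apply: ler_pM => //; exact: exprn_ge0.
have -> : 7 * (x * y) * (1 / y) ^+ 2 = 7 * (x / y) by field; rewrite gt_eqF.
by move: xyv; lra.
Qed.

Lemma column_bound (Sp k : R) : p = expR (- y) -> 0 <= Sp -> Sp <= 6 * (x * y) ->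
  0 <= k -> k <= 2 * x -> Sp * k * p <= v.
Proof.
move=> pE Sp0 Sx k0 kx.
have p0 : 0 <= p by rewrite pE expR_ge0.
have py : y ^+ 3 * p <= 27.
  have e1 : expR y * p = 1 by rewrite pE -expRD subrr expR0.
  by have := ler_wpM2r p0 (expR_ge_cube (ltW y0)); rewrite -[27 * _ * _]mulrA e1 mulr1.
have h1 : Sp * k <= 3 * y ^+ 2.
  apply: (@le_trans _ _ (3 * (4 * x ^+ 2) * y)).
    have -> : 3 * (4 * x ^+ 2) * y = 6 * (x * y) * (2 * x) by ring.
    exact: ler_pM.
  have -> : 3 * y ^+ 2 = 3 * y * y by ring.
  by rewrite ler_pM2r // ler_pM2l.
rewrite -(ler_pM2r y0); apply: (@le_trans _ _ (3 * (y ^+ 3 * p))).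
  have -> : 3 * (y ^+ 3 * p) = 3 * y ^+ 2 * p * y by ring.
  by rewrite ler_pM2r // ler_wpM2r.
by move: yv x108; lra.
Qed.
End DefectBounds.

(** The choice of scales, with [y = log (1/p)] and [x = log y]. Shadows have length
[r] about [x / p], since [exp (- x) = 1 / y] is small enough for the number of
closed sites in a box. Blocks have height [l] about [2 * y / p], since columns
have to be nonempty up to [p ^ 2]. A box contains about [x] blocks on top of
each other, and a strip about [x] lanes next to each other, so that the events
that all of them fail have probability at most [exp (- 2 * x)]. All defects
but the last are controlled by [x ^ 2 * y * (q / p ^ 2) <= 1 / x ^ 2], which is
where the bound on [q] enters. *)
Lemma box_status_bad_small (R : realType) (p q x y : R) :
  0 < p -> 0 <= q -> p + q <= 1 -> 108 <= x -> y = expR x -> p = expR (- y) ->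
  q <= p ^+ 2 / (y * x ^+ 4) ->
  exists r K m : nat, [/\ (0 < r)%N, (0 < K)%N, (0 < m)%N &
    box_status_law p q r K m None <= 32 / x].
Proof.
move=> p0 q0 pq x108 yE pE qle.
have x0 : 0 < x by lra.
have y0 : 0 < y by rewrite yE expR_gt0.
have xy : 4 * x ^+ 2 <= y.
  have := @expR_ge_cube R x (ltW x0); rewrite -yE => h.
  have : 108 * x ^+ 2 <= x ^+ 3 by rewrite [x ^+ 3]exprS ler_wpM2r ?exprn_ge0 // ltW.
  lra.
have p1 : p <= 1 by lra.
have [K [K0 xK Kx]] := nat_above (ltW x0).
have [r [r0 xr rx]] := @nat_above R (x / p) (divr_ge0 (ltW x0) (ltW p0)).
have w0 : 0 < (K * r)%:R * p by rewrite mulr_gt0 // ltr0n muln_gt0 K0.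
have [m [m0 ym my]] := @nat_above R (2 * y / ((K * r)%:R * p)) (divr_ge0 (mulr_ge0 (ler0n _ 2) (ltW y0)) (ltW w0)).
exists r, K, m; split=> //.
apply: (le_trans (box_status_bad_le r K m (ltW p0) q0 pq)).
apply: (le_trans (ler_wpM2l _ (box_bad_le K m (ltW p0) q0 pq r0))) => //.
pose s := q / p ^+ 2.
have qE : q = s * p ^+ 2 by rewrite divfK // expf_neq0 // gt_eqF.
have s0 : 0 <= s by rewrite divr_ge0 ?exprn_ge0 // ltW.
set v := 1 / x; have xv : x * v = 1 by rewrite /v mulrCA divff ?mulr1 // gt_eqF.
have v0 : 0 < v by rewrite divr_gt0.
have v108 : v <= 1 / 108 by rewrite /v ler_pdivrMr //; lra.
have usq : x ^+ 2 * (y * s) <= v ^+ 2.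
  have : y * s <= v ^+ 4.
    rewrite /s mulrA ler_pdivrMr ?exprn_gt0 //; apply: le_trans (ler_wpM2l (ltW y0) qle) _.
    suff -> : y * (p ^+ 2 / (y * x ^+ 4)) = v ^+ 4 * p ^+ 2 by [].
    by rewrite /v; field; rewrite !gt_eqF.
  move/(ler_wpM2l (exprn_ge0 2 (ltW x0)))/le_trans; apply.
  by rewrite -[4%N]/(2 + 2)%N exprD mulrA -exprMn xv expr1n mul1r.
have yinv : x / y <= v / 4.
  rewrite ler_pdivrMr // mulrAC ler_pdivlMr //.
  by have := ler_wpM2l (ltW v0) xy; rewrite expr2; nra.
have ex : expR (- x) = 1 / y by rewrite expRN -yE mul1r.
set rho := r%:R in xr rx w0 ym my *; set k := K%:R in xK Kx w0 ym my *.
set mm := m%:R in ym my *.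
pose A := rho * p; pose W := k * A; pose Lp := mm * W; pose Sp := k * Lp.
have A_ge : x <= A by rewrite -ler_pdivrMr.
have A_le : A <= x + 1.
  by have := ler_wpM2r (ltW p0) rx; rewrite mulrDl divfK ?gt_eqF // mul1r /A; lra.
have k0 : 0 < k by lra.
have W_ge : 1 <= W by rewrite /W; nra.
have W_le : W <= 4 * x ^+ 2 by rewrite /W expr2; nra.
have WE : (K * r)%:R * p = W by rewrite natrM /W /A mulrA.
rewrite WE in ym my.
have W0 : 0 < W by lra.
have L_ge : 2 * y <= Lp by rewrite /Lp -ler_pdivrMr.
have L_le : Lp <= 3 * y.
  have := ler_wpM2r (ltW W0) my; rewrite mulrDl divfK ?gt_eqF // mul1r /Lp; lra.
have mm_ge0 : 0 <= mm by rewrite /mm ler0n.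
have mm_le : mm <= 3 * y by apply: le_trans L_le; rewrite /Lp ler_peMr.
have Lp0 : 0 <= Lp by rewrite mulr_ge0 // ltW.
have Sp0 : 0 <= Sp by rewrite mulr_ge0 // ltW.
have S_le : Sp <= 6 * (x * y).
  apply: (@le_trans _ _ ((2 * x) * (3 * y))); last lra.
  by apply: ler_pM => //; lra.
have km_le : k * mm <= 6 * (x * y).
  apply: (@le_trans _ _ ((2 * x) * (3 * y))); last lra.
  by apply: ler_pM => //; lra.
have p01 : 0 <= p <= 1 by rewrite (ltW p0) p1.
have [x0' y0' p0'] : [/\ 0 <= x, 0 <= y & 0 <= p] by rewrite !ltW.
have [v0' k0' W0' A0'] : [/\ 0 <= v, 0 <= k, 0 <= W & 0 <= A] by split; lra.
(* From here on the geometric quantities are measured in units of [1 / p]: [A], [W],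
   [Lp] and [Sp] are the shadow length, the strip width, the block height and the
   box side, and [s] is the density of closed sites. *)
have [pA pL] : (1 - p) ^+ r <= 1 / y /\ (1 - p) ^+ (m * (K * r)) <= p ^+ 2.
  split; apply: (le_trans (exprn_onem_le _ p01)).
    by rewrite -ex ler_expR lerN2 mulrC.
  rewrite [in leRHS]pE -expRM_natl ler_expR.
  by rewrite !natrM [p * _]mulrC -!mulrA -/rho -/k -/mm -/A -/W -/Lp; lra.
have SE : (box_side r K m)%:R = Sp / p.
  by rewrite /box_side !natrM -/rho -/k -/mm /Sp /Lp /W /A; field; rewrite gt_eqF.
move: (box_side r K m) SE => S SE.
have lE : (m * (K * r))%:R = Lp / p.
  by rewrite !natrM -/rho -/k -/mm /Lp /W /A; field; rewrite gt_eqF.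
have wE : (K * r).*2%:R = 2 * W / p.
  by rewrite -muln2 !natrM -/rho -/k /W /A; field; rewrite gt_eqF.
have rE : r%:R = A / p by rewrite /A mulfK // gt_eqF.
have r2E : r.*2.+1%:R = (2 * A + p) / p.
  by rewrite -natr1 -muln2 natrM -/rho /A; field; rewrite gt_eqF.
have A2 : A <= 2 * x by lra.
have k2 : k <= 2 * x by lra.
have pA1 : p <= A by lra.
have T1 : (S * S * (r.*2.+1 * r.*2.+1))%:R * q ^+ 2 <= v.
  rewrite !natrM SE r2E qE.
  have -> : Sp / p * (Sp / p) * ((2 * A + p) / p * ((2 * A + p) / p)) *
      (s * p ^+ 2) ^+ 2 = (Sp * (2 * A + p) * s) ^+ 2.
    by clear -p0; field; rewrite gt_eqF.
  by apply: (@pair_bound _ _ s x y).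
have ASs : A * Sp * s <= v / 9 by apply: (@shadow_bound _ s x y).
have ASs0 : 0 <= A * Sp * s by do 2 (apply: mulr_ge0 => //).
have T2 : (4 * (r * S))%:R * q <= v.
  rewrite !natrM SE rE qE.
  have -> : 4 * (A / p * (Sp / p)) * (s * p ^+ 2) = 4 * (A * Sp * s).
    by clear -p0; field; rewrite gt_eqF.
  by clear -ASs v0'; lra.
have T3 : (3 * (S * S))%:R * (q * (1 - p) ^+ r) <= v.
  rewrite !natrM SE qE.
  apply: (@le_trans _ _ (3 * (Sp / p * (Sp / p)) * (s * p ^+ 2 * (1 / y)))).
    apply: ler_wpM2l; first by do 2 (apply: mulr_ge0 => //); apply: divr_ge0.
    by apply: ler_wpM2l => //; apply: mulr_ge0 => //; exact: exprn_ge0.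
  have -> : 3 * (Sp / p * (Sp / p)) * (s * p ^+ 2 * (1 / y)) = 3 * (Sp * Sp * s) / y.
    by clear -p0 y0; field; rewrite !gt_eqF.
  by apply: (@arm_bound _ s x y).
have km0 : 0 <= k * mm by apply: mulr_ge0.
have xy1 : 1 <= x * y by clear -x108 xy; nra.
have T4 : (K * m)%:R * ((r * S)%:R * q) ^+ K <= 2 * v.
  rewrite !natrM SE rE qE -/k -/mm.
  have -> : A / p * (Sp / p) * (s * p ^+ 2) = A * Sp * s.
    by clear -p0; field; rewrite gt_eqF.
  apply: (@power_bound _ x y) => //.
    by rewrite -/v; clear -ASs v0'; lra.
  by clear -km_le xy1; lra.
have T5 : (K * m).+1%:R * (((K * r).*2 * (m * (K * r)))%:R * q) ^+ K <= 2 * v.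
  rewrite -natr1 [(_ * (m * _))%:R]natrM lE wE natrM qE -/k -/mm.
  have -> : 2 * W / p * (Lp / p) * (s * p ^+ 2) = 2 * W * Lp * s.
    by clear -p0; field; rewrite gt_eqF.
  apply: (@power_bound _ x y) => //.
  - by do 3 (apply: mulr_ge0 => //).
  - by apply: (@block_bound _ s x y).
  - by clear -km0; lra.
  - by clear -km_le xy1; lra.
have T6 : (S * K)%:R * (1 - p) ^+ (m * (K * r)) <= v.
  rewrite natrM SE -/k.
  apply: (@le_trans _ _ (Sp / p * k * p ^+ 2)).
    by apply: ler_wpM2l => //; apply: mulr_ge0 => //; apply: divr_ge0.
  have -> : Sp / p * k * p ^+ 2 = Sp * k * p by clear -p0; field; rewrite gt_eqF.
  by apply: (@column_bound _ p x y).
have -> : 32 / x = 32 * v by rewrite /v mulrA mulr1.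
by clear -T1 T2 T3 T4 T5 T6; lra.
Qed.

(** * The final density *)

Theorem theorem1p2 (R : realType) (eta : R) (heta : 0 < eta) :
  exists p0 : R, [/\ 0 < p0, p0 < (expR 1)^-1 &
    forall p q : R, 0 < p -> p < p0 -> 0 <= q -> p + q <= 1 ->
      q <= p ^+ 2 / (ln p^-1 * ln (ln p^-1) ^+ 4) ->
      forall (d : measure_display) (T : measurableType d)
        (P : probability T R) (X : Z2 -> {RV P >-> site_state}),
        polluted_initial_field p q X ->
        ((1 - eta)%:E <=
           P [set w | eventually_occupied (fun x => X x w) (0, 0)%R])%E].
Proof.
(* With [x >= x0] the bound [32 / x] on the probability of a bad box is below both
   [1 / 162], which starts the hierarchy, and [eta / 4]. *)
pose x0 := 5200 + 128 / eta.
have eta_inv : 0 < 128 / eta by rewrite divr_gt0.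
exists (expR (- expR x0)); split; first exact: expR_gt0.
  by rewrite -expRN ltr_expR ltrN2 expR_gt1 /x0; lra.
move=> p q p_gt0 p_lt q_ge0 pq q_le d T P X fX.
pose y := ln p^-1; pose x := ln y.
have yE : y = - ln p by rewrite /y lnV ?posrE.
have pE : p = expR (- y) by rewrite yE opprK lnK ?posrE.
have y_gt : expR x0 < y.
  by move: p_lt; rewrite [in X in X -> _]pE ltr_expR ltrN2.
have y_gt0 : 0 < y by apply: lt_trans y_gt; exact: expR_gt0.
have yx : y = expR x by rewrite lnK ?posrE.
have x_gt : x0 < x by rewrite -ltr_expR -yx.
have x108 : 108 <= x by rewrite /x0 in x_gt; lra.
have [r [K [m [r0 K0 m0 small]]]] :=
  box_status_bad_small p_gt0 q_ge0 pq x108 yx pE q_le.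
have x_gt0 : 0 < x by lra.
have small1 : 32 / x <= eta / 4.
  rewrite ler_pdivrMr // mulrAC ler_pdivlMr //.
  have : 128 / eta < x by rewrite /x0 in x_gt; lra.
  by rewrite ltr_pdivrMr //; lra.
have small2 : 32 / x <= 1 / 162.
  by rewrite ler_pdivrMr //; rewrite /x0 in x_gt; lra.
apply: le_trans (@origin_occupied_ge _ _ _ _ p q (eta / 2) X r K m r0 K0 m0
  p_gt0 q_ge0 pq fX _ _); last 2 first.
- lra.
- by rewrite divr_gt0.
by rewrite lee_fin; lra.
Qed.
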